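(* Let $q\in\mathbb{C}^*$ be not a root of unity and $\alpha,\beta\in\mathbb{C}$. In $\mathcal{L}U_qsl_2\otimes\mathcal{L}U_qsl_2$, each of the pairs $(W_0,W_1)=(\Delta(\widehat{A}),\Delta(\widehat{B}))$ and $(W_0,W_1)=(\overline{\Delta}(\widehat{A}),\overline{\Delta}(\widehat{B}))$ satisfies the $q$-Dolan--Grady relations $$[W_0,[W_0,[W_0,W_1]_q]_{q^{-1}}]=\rho\,[W_0,W_1],\qquad [W_1,[W_1,[W_1,W_0]_q]_{q^{-1}}]=\rho\,[W_1,W_0]$$ with $\rho=-(q^2-q^{-2})^2$.
   Context: $[X,Y]_q=qXY-q^{-1}YX$ and $[X,Y]=XY-YX$. The quantum loop algebra $\mathcal{L}U_qsl_2$ is the unital associative $\mathbb{C}$-algebra generated by $e_i,f_i,k_i^{\pm1}$, $i\in\{0,1\}$, with relations (where $a_{ii}=2$, $a_{ij}=-2$ for $i\ne j$): $k_ie_j=q^{a_{ij}/2}e_jk_i$, $k_if_j=q^{-a_{ij}/2}f_jk_i$, $[e_i,f_j]=\delta_{i,j}\frac{k_i^2-k_i^{-2}}{q-q^{-1}}$, $k_ik_i^{-1}=k_i^{-1}k_i=1$, $k_0k_1=k_1k_0=1$, and for $i\neq j$: $[e_i,[e_i,[e_i,e_j]_q]_{q^{-1}}]=0$, $[f_i,[f_i,[f_i,f_j]_q]_{q^{-1}}]=0$. The coproduct $\Delta$ is the algebra homomorphism with $\Delta(e_i)=e_i\otimes k_i^{-1}+k_i\otimes e_i$, $\Delta(f_i)=f_i\otimes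 k_i^{-1}+k_i\otimes f_i$, $\Delta(k_i^{\pm1})=k_i^{\pm1}\otimes k_i^{\pm1}$; $\overline{\Delta}=\sigma\circ\Delta$ with $\sigma(x\otimes y)=y\otimes x$. $\widehat{A}=(q-q^{-1})(e_1k_1-f_1k_1)+\alpha k_1^2$, $\widehat{B}=(q-q^{-1})(f_0k_0-e_0k_0)+\beta k_0^2$. *)

(* Defs.v *)
From HB Require Import structures.
From mathcomp Require Import all_boot all_order all_algebra.
From mathcomp Require Import monalg.
From mathcomp Require Import boolp classical_sets.
From mathcomp Require Import ring.

Set Implicit Arguments.
Unset Strict Implicit.
Unset Printing Implicit Defensive.

Import GRing.Theory.

Local Open Scope ring_scope.
Local Open Scope quotient_scope.

(* Two-sided ideal generated by the elements satisfying r: the finite sums of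
   a * x * b with r x. *)
Inductive ideal_gen (A : nzRingType) (r : A -> Prop) : A -> Prop :=
| ideal_gen0 : ideal_gen r 0
| ideal_genD x y : ideal_gen r x -> ideal_gen r y -> ideal_gen r (x + y)
| ideal_genM a x b : r x -> ideal_gen r (a * x * b).

Section IdealQuotient.
Variables (C : fieldType) (A : algType C) (r : A -> Prop).

Lemma ideal_genMl a x : ideal_gen r x -> ideal_gen r (a * x).
Proof.
elim=> [|u v _ hu _ hv|b u c ru]; first by rewrite mulr0; constructor.
  by rewrite mulrDr; apply: ideal_genD.
by rewrite !mulrA; apply: ideal_genM.
Qed.

Lemma ideal_genMr b x : ideal_gen r x -> ideal_gen r (x * b).
Proof.
elim=> [|u v _ hu _ hv|a u c ru]; first by rewrite mul0r; constructor.
  by rewrite mulrDl; apply: ideal_genD.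
by rewrite -mulrA; apply: ideal_genM.
Qed.

Lemma ideal_genZ c x : ideal_gen r x -> ideal_gen r (c *: x).
Proof. by rewrite -mulr_algl; apply: ideal_genMl. Qed.

Lemma ideal_genN x : ideal_gen r x -> ideal_gen r (- x).
Proof. by rewrite -mulN1r; apply: ideal_genMl. Qed.

Definition ideal_rel : rel A := fun x y => `[< ideal_gen r (x - y) >].

Lemma ideal_rel_equiv : equiv_class_of ideal_rel.
Proof.
split=> [x|x y|y x z].
- by apply/asboolP; rewrite subrr; constructor.
- by apply/asboolP/asboolP => /ideal_genN; rewrite opprB.
- move=> /asboolP hxy /asboolP hyz; apply/asboolP.
  by rewrite -(subrKA y); apply: ideal_genD.
Qed.
Canonical ideal_rel_eqrel := EquivRelPack ideal_rel_equiv.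

(* The quotient is only a pzRingType here, since 1 may lie in the ideal. *)
Definition ideal_quot := {eq_quot ideal_rel}.
HB.instance Definition _ := EqQuotient.on ideal_quot.
HB.instance Definition _ := Choice.on ideal_quot.

Local Notation Q := ideal_quot.
Local Notation pi := (\pi_Q : A -> Q).

Lemma ideal_piE x y : ideal_gen r (x - y) <-> pi x = pi y.
Proof. by split=> [h|/eqmodP/asboolP //]; apply/eqmodP/asboolP. Qed.

Lemma ideal_pi_repr x : ideal_gen r (repr (pi x) - x).
Proof. by apply/ideal_piE; rewrite reprK. Qed.

Definition iq_zero : Q := pi 0.
Definition iq_one : Q := pi 1.
Definition iq_opp := lift_op1 Q (-%R : A -> A).
Definition iq_add := lift_op2 Q (+%R : A -> A -> A).
Definition iq_mul := lift_op2 Q ( *%R : A -> A -> A).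
Definition iq_scale (c : C) := lift_op1 Q ( *:%R c : A -> A).

Lemma iq_oppE x : iq_opp (pi x) = pi (- x).
Proof.
unlock iq_opp; apply/eqmodP/asboolP => /=; rewrite -opprD.
exact/ideal_genN/ideal_pi_repr.
Qed.
Lemma iq_addE x y : iq_add (pi x) (pi y) = pi (x + y).
Proof.
unlock iq_add; apply/eqmodP/asboolP => /=; rewrite opprD addrACA.
by apply: ideal_genD; apply: ideal_pi_repr.
Qed.
Lemma iq_mulE x y : iq_mul (pi x) (pi y) = pi (x * y).
Proof.
unlock iq_mul; apply/eqmodP/asboolP => /=; rewrite -(subrKA (repr (pi x) * y)) -mulrBr -mulrBl.
by apply: ideal_genD; [apply: ideal_genMl|apply: ideal_genMr];
  apply: ideal_pi_repr.
Qed.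
Lemma iq_scaleE c x : iq_scale c (pi x) = pi (c *: x).
Proof.
unlock iq_scale; apply/eqmodP/asboolP => /=; rewrite -scalerBr.
exact/ideal_genZ/ideal_pi_repr.
Qed.

Let iqE := (iq_oppE, iq_addE, iq_mulE, iq_scaleE).

Lemma iq_addA : associative iq_add.
Proof.
move=> x y z; rewrite -[x]reprK -[y]reprK -[z]reprK.
by rewrite !iqE addrA.
Qed.
Lemma iq_addC : commutative iq_add.
Proof. by move=> x y; rewrite -[x]reprK -[y]reprK !iqE addrC. Qed.
Lemma iq_add0 : left_id iq_zero iq_add.
Proof. by move=> x; rewrite -[x]reprK !iqE add0r. Qed.
Lemma iq_addN : left_inverse iq_zero iq_opp iq_add.
Proof. by move=> x; rewrite -[x]reprK !iqE addNr. Qed.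
HB.instance Definition _ :=
  GRing.isZmodule.Build Q iq_addA iq_addC iq_add0 iq_addN.

Lemma iq_mulA : associative iq_mul.
Proof.
move=> x y z; rewrite -[x]reprK -[y]reprK -[z]reprK.
by rewrite !iqE mulrA.
Qed.
Lemma iq_mul1l : left_id iq_one iq_mul.
Proof. by move=> x; rewrite -[x]reprK !iqE mul1r. Qed.
Lemma iq_mul1r : right_id iq_one iq_mul.
Proof. by move=> x; rewrite -[x]reprK !iqE mulr1. Qed.
Lemma iq_mulDl : left_distributive iq_mul iq_add.
Proof.
move=> x y z; rewrite -[x]reprK -[y]reprK -[z]reprK.
by rewrite !iqE mulrDl.
Qed.
Lemma iq_mulDr : right_distributive iq_mul iq_add.
Proof.
move=> x y z; rewrite -[x]reprK -[y]reprK -[z]reprK.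
by rewrite !iqE mulrDr.
Qed.
HB.instance Definition _ :=
  GRing.Zmodule_isPzRing.Build Q iq_mulA iq_mul1l iq_mul1r iq_mulDl iq_mulDr.

Lemma iq_scaleA a b x : iq_scale a (iq_scale b x) = iq_scale (a * b) x.
Proof. by rewrite -[x]reprK !iqE scalerA. Qed.
Lemma iq_scale1 : left_id 1 iq_scale.
Proof. by move=> x; rewrite -[x]reprK !iqE scale1r. Qed.
Lemma iq_scaleDr : right_distributive iq_scale +%R.
Proof. by move=> c x y; rewrite -[x]reprK -[y]reprK; rewrite /GRing.add/= !iqE scalerDr. Qed.
Lemma iq_scaleDl x : {morph iq_scale^~ x : a b / a + b}.
Proof. by move=> a b; rewrite -[x]reprK; rewrite /GRing.add/= !iqE scalerDl. Qed.
HB.instance Definition _ :=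
  GRing.Zmodule_isLmodule.Build C Q iq_scaleA iq_scale1 iq_scaleDr iq_scaleDl.

Lemma iq_piB : {morph pi : x y / x - y}.
Proof. by move=> x y; rewrite /GRing.add /GRing.opp /= !iqE. Qed.
End IdealQuotient.

(* The free associative unital algebra on X: finitely supported functions on
   the free monoid of words in X, with the convolution product. *)
Definition free_alg (C : fieldType) (X : choiceType) : Type :=
  {malg C[{fmonom X}]}.

Section FreeAlgebra.
Variables (C : fieldType) (X : choiceType).
HB.instance Definition _ :=
  GRing.Lalgebra.copy (free_alg C X) {malg C[{fmonom X}]}.

Lemma free_alg_scaleAr (c : C) (x y : free_alg C X) :
  c *: (x * y) = x * (c *: y).
Proof.
have malgCC (g : {malg C[{fmonom X}]}) : g * c%:MP = c *: g.
  rewrite malgM_def malgZ_def fgmulgU; apply: eq_bigr => /= k _.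
  by rewrite mulm1 mulrC.
have malgAr (g g' : {malg C[{fmonom X}]}) : c *: (g * g') = g * (c *: g').
  by rewrite scalerAl -[c *: g]malgCC -mulrA mul_malgC.
exact: malgAr.
Qed.
HB.instance Definition _ :=
  GRing.Lalgebra_isAlgebra.Build C (free_alg C X) free_alg_scaleAr.

Definition fa_gen (x : X) : free_alg C X := << fmu x >>.

Variables (B : algType C) (h : X -> B).
Definition fa_word (m : {fmonom X}) : B := \prod_(i <- m) h i.
Lemma fa_word_mmorphism : mmorphism fa_word.
Proof.
by split=> [m n|]; rewrite /fa_word ?fmM ?fm1 ?big_cat ?big_nil.
Qed.
HB.instance Definition _ := isMultiplicative.Build _ _ fa_word fa_word_mmorphism.

Definition fa_eval (x : free_alg C X) : B := mmap (in_alg B) fa_word x.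

Lemma fa_eval_zmod : zmod_morphism fa_eval.
Proof. exact: (@raddfB _ _ (mmap (in_alg B) fa_word)). Qed.
HB.instance Definition _ := GRing.isZmodMorphism.Build _ _ fa_eval fa_eval_zmod.

Lemma fa_eval_monoid : monoid_morphism fa_eval.
Proof.
suff [hM h1] : multiplicative (mmap (in_alg B) fa_word) by split.
apply: commr_mmap_is_multiplicative => g m m'.
by rewrite /GRing.comm /= mulr_algl mulr_algr.
Qed.
HB.instance Definition _ := GRing.isMonoidMorphism.Build _ _ fa_eval fa_eval_monoid.

Lemma fa_eval_scalable : scalable fa_eval.
Proof.
by move=> c g; rewrite /fa_eval [LHS](mmapZ (f := in_alg B)) /= mulr_algl.
Qed.
HB.instance Definition _ :=
  GRing.isScalable.Build C (free_alg C X) B *:%R fa_eval fa_eval_scalable.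

Lemma fa_eval_gen x : fa_eval (fa_gen x) = h x.
Proof.
by rewrite /fa_eval [LHS]mmapU /= scale1r mul1r /fa_word fmU big_seq1.
Qed.
End FreeAlgebra.

Section IdealKernel.
Variables (A B : nzRingType) (r : A -> Prop) (g : {rmorphism A -> B}).
Hypothesis g_r : forall x, r x -> g x = 0.

Lemma ideal_gen_ker x : ideal_gen r x -> g x = 0.
Proof.
elim=> [|y z _ hy _ hz|a y b ry]; first exact: rmorph0.
  by rewrite rmorphD hy hz addr0.
by rewrite !rmorphM (g_r ry) mulr0 mul0r.
Qed.
End IdealKernel.

Section Brackets.
Variables (C : fieldType) (A : algType C).
Definition qbracket (q : C) (X Y : A) : A := q *: (X * Y) - q^-1 *: (Y * X).
Definition bracket (X Y : A) : A := X * Y - Y * X.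
Definition serre (q : C) (X Y : A) : A :=
  bracket X (qbracket q^-1 X (qbracket q X Y)).
End Brackets.

Section BracketMorph.
Variables (C : fieldType) (A B : algType C) (g : {lrmorphism A -> B}).
Let gZ c (x : A) : g (c *: x) = c *: g x. Proof. exact: linearZ_LR. Qed.
Let gB (x y : A) : g (x - y) = g x - g y. Proof. exact: rmorphB. Qed.
Let gM (x y : A) : g (x * y) = g x * g y. Proof. exact: rmorphM. Qed.
Lemma rmorph_qbracket q X Y : g (qbracket q X Y) = qbracket q (g X) (g Y).
Proof. by rewrite /qbracket gB !gZ !gM. Qed.
Lemma rmorph_bracket X Y : g (bracket X Y) = bracket (g X) (g Y).
Proof. by rewrite /bracket gB !gM. Qed.
Lemma rmorph_serre q X Y : g (serre q X Y) = serre q (g X) (g Y).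
Proof. by rewrite /serre rmorph_bracket !rmorph_qbracket. Qed.
End BracketMorph.

Section RelatorMorph.
Variables (C : fieldType) (A B : algType C) (g : {lrmorphism A -> B}).
Let gZ c (x : A) : g (c *: x) = c *: g x. Proof. exact: linearZ_LR. Qed.
Let gB (x y : A) : g (x - y) = g x - g y. Proof. exact: rmorphB. Qed.
Let gM (x y : A) : g (x * y) = g x * g y. Proof. exact: rmorphM. Qed.
Lemma rmorph_qcomm_rel c x y :
  g (x * y - c *: (y * x)) = g x * g y - c *: (g y * g x).
Proof. by rewrite gB gZ !gM. Qed.
Lemma rmorph_ef_rel a b x y k l :
  g (bracket x y - a *: (b *: (k ^+ 2 - l ^+ 2)))
  = bracket (g x) (g y) - a *: (b *: (g k ^+ 2 - g l ^+ 2)).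
Proof.
by rewrite gB rmorph_bracket !gZ gB !expr2 !gM.
Qed.
Lemma rmorph_inv_rel x y : g (x * y - 1) = g x * g y - 1.
Proof. by rewrite gB gM (rmorph1 g). Qed.
End RelatorMorph.

Section RelatorTrivial.
Variables (C : fieldType) (B : algType C).
Lemma qcomm_rel0 c (x : B) : x * 0 - c *: (0 * x) = 0.
Proof. by rewrite mulr0 mul0r scaler0 subrr. Qed.
Lemma ef_rel0 a b (x : B) :
  bracket 0 0 - a *: (b *: (x ^+ 2 - x ^+ 2)) = 0.
Proof. by rewrite /bracket mulr0 !subrr !scaler0 subrr. Qed.
Lemma inv_rel0 : 1 * 1 - 1 = 0 :> B.
Proof. by rewrite mulr1 subrr. Qed.
Lemma serre_rel0 q (x : B) : serre q 0 x = 0.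
Proof. by rewrite /serre /bracket mul0r mulr0 subrr. Qed.
End RelatorTrivial.

Inductive loop_gen := LE of 'I_2 | LF of 'I_2 | LK of 'I_2 | LKinv of 'I_2.

Definition loop_gen_code (x : loop_gen) : ('I_2 + 'I_2) + ('I_2 + 'I_2) :=
  match x with
  | LE i => inl (inl i) | LF i => inl (inr i)
  | LK i => inr (inl i) | LKinv i => inr (inr i)
  end.
Definition loop_gen_decode (x : ('I_2 + 'I_2) + ('I_2 + 'I_2)) : loop_gen :=
  match x with
  | inl (inl i) => LE i | inl (inr i) => LF i
  | inr (inl i) => LK i | inr (inr i) => LKinv i
  end.
Lemma loop_gen_codeK : cancel loop_gen_code loop_gen_decode.
Proof. by case. Qed.
HB.instance Definition _ := Choice.copy loop_gen (can_type loop_gen_codeK).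

Definition cartan (i j : 'I_2) : int := if i == j then 2 else -2.

Section LoopAlgebra.
Variables (C : fieldType) (q : C).

Local Notation FA := (free_alg C loop_gen).
Local Notation E i := (fa_gen C (LE i)).
Local Notation F i := (fa_gen C (LF i)).
Local Notation K i := (fa_gen C (LK i)).
Local Notation K' i := (fa_gen C (LKinv i)).

(* Each relation u = v is imposed by putting u - v in the ideal.  The entries
   of cartan are even, so the division by 2 is exact. *)
Inductive loop_relator : FA -> Prop :=
| relKE i j : loop_relator (K i * E j - q ^ (cartan i j %/ 2)%Z *: (E j * K i))
| relKF i j :
    loop_relator (K i * F j - q ^ (- cartan i j %/ 2)%Z *: (F j * K i))
| relEF i j : loop_relator
    (bracket (E i) (F j)
     - (i == j)%:R *: ((q - q^-1)^-1 *: (K i ^+ 2 - K' i ^+ 2)))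
| relKK' i : loop_relator (K i * K' i - 1)
| relK'K i : loop_relator (K' i * K i - 1)
| relK0K1 : loop_relator (K 0 * K 1 - 1)
| relK1K0 : loop_relator (K 1 * K 0 - 1)
| relSerreE i j : i != j -> loop_relator (serre q (E i) (E j))
| relSerreF i j : i != j -> loop_relator (serre q (F i) (F j)).

Definition loop_alg : Type := ideal_quot loop_relator.
HB.instance Definition _ := EqQuotient.on loop_alg.
HB.instance Definition _ := Choice.on loop_alg.
HB.instance Definition _ := GRing.PzRing.on loop_alg.
HB.instance Definition _ := GRing.Lmodule.on loop_alg.

Local Notation U := loop_alg.
Definition loop_pi (x : FA) : U := \pi_U x.

(* The counit (E, F |-> 0 and K, K^-1 |-> 1) shows that the algebra is nonzero. *)
Definition counit_gen (x : loop_gen) : C^o :=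
  match x with LE _ | LF _ => 0 | _ => 1 end.

Lemma counit_relator x : loop_relator x -> fa_eval counit_gen x = 0.
Proof.
case=> [i j|i j|i j|i|i|||i j _|i j _].
- by rewrite rmorph_qcomm_rel /= !fa_eval_gen; apply: qcomm_rel0.
- by rewrite rmorph_qcomm_rel /= !fa_eval_gen; apply: qcomm_rel0.
- by rewrite rmorph_ef_rel /= !fa_eval_gen; apply: ef_rel0.
- by rewrite rmorph_inv_rel /= !fa_eval_gen; apply: inv_rel0.
- by rewrite rmorph_inv_rel /= !fa_eval_gen; apply: inv_rel0.
- by rewrite rmorph_inv_rel /= !fa_eval_gen; apply: inv_rel0.
- by rewrite rmorph_inv_rel /= !fa_eval_gen; apply: inv_rel0.
- by rewrite rmorph_serre /= !fa_eval_gen; apply: serre_rel0.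
- by rewrite rmorph_serre /= !fa_eval_gen; apply: serre_rel0.
Qed.

Lemma loop_oner_neq0 : 1 != 0 :> U.
Proof.
apply/eqP => h; have : fa_eval counit_gen (1 : FA) = 0.
  apply: (ideal_gen_ker counit_relator).
  by rewrite -[1]subr0; apply/ideal_piE.
by rewrite rmorph1 => /eqP; rewrite oner_eq0.
Qed.
HB.instance Definition _ := GRing.PzSemiRing_isNonZero.Build U loop_oner_neq0.

Lemma loop_pi_zmod : zmod_morphism loop_pi.
Proof. exact: iq_piB. Qed.
HB.instance Definition _ := GRing.isZmodMorphism.Build FA U loop_pi loop_pi_zmod.
Lemma loop_pi_monoid : monoid_morphism loop_pi.
Proof. by split=> // x y; rewrite /loop_pi -iq_mulE. Qed.
HB.instance Definition _ := GRing.isMonoidMorphism.Build FA U loop_pi loop_pi_monoid.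
Lemma loop_pi_scalable : scalable loop_pi.
Proof. by move=> c x; rewrite /loop_pi -iq_scaleE. Qed.
HB.instance Definition _ :=
  GRing.isScalable.Build C FA U *:%R loop_pi loop_pi_scalable.

Lemma loop_piK (x : U) : loop_pi (repr x) = x.
Proof. exact: reprK. Qed.

Lemma loop_scaleAl (c : C) (x y : U) : c *: (x * y) = (c *: x) * y.
Proof.
by rewrite -[x]loop_piK -[y]loop_piK -rmorphM -!linearZ -rmorphM -scalerAl.
Qed.
HB.instance Definition _ := GRing.Lmodule_isLalgebra.Build C U loop_scaleAl.
Lemma loop_scaleAr (c : C) (x y : U) : c *: (x * y) = x * (c *: y).
Proof.
by rewrite -[x]loop_piK -[y]loop_piK -rmorphM -!linearZ -rmorphM -scalerAr.
Qed.
HB.instance Definition _ := GRing.Lalgebra_isAlgebra.Build C U loop_scaleAr.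

Definition loopE i : U := loop_pi (E i).
Definition loopF i : U := loop_pi (F i).
Definition loopK i : U := loop_pi (K i).
Definition loopKinv i : U := loop_pi (K' i).

Section Lift.
Variables (B : algType C) (h : loop_gen -> B).
Hypothesis h_rel : forall x, loop_relator x -> fa_eval h x = 0.

Definition loop_lift (_ : forall x, loop_relator x -> fa_eval h x = 0) (x : U)
  : B := fa_eval h (repr x).
Local Notation lift := (loop_lift h_rel).

Lemma loop_lift_pi x : lift (loop_pi x) = fa_eval h x.
Proof.
apply/eqP; rewrite -subr_eq0 -rmorphB; apply/eqP.
exact/(ideal_gen_ker h_rel)/ideal_pi_repr.
Qed.

Lemma loop_lift_zmod : zmod_morphism lift.
Proof.
by move=> x y; rewrite -[x]loop_piK -[y]loop_piK -rmorphB !loop_lift_pi rmorphB.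
Qed.
HB.instance Definition _ := GRing.isZmodMorphism.Build U B lift loop_lift_zmod.
Lemma loop_lift_monoid : monoid_morphism lift.
Proof.
split=> [|x y]; first by rewrite -(rmorph1 loop_pi) loop_lift_pi rmorph1.
by rewrite -[x]loop_piK -[y]loop_piK -rmorphM !loop_lift_pi rmorphM.
Qed.
HB.instance Definition _ := GRing.isMonoidMorphism.Build U B lift loop_lift_monoid.
Lemma loop_lift_scalable : scalable lift.
Proof.
by move=> c x; rewrite -[x]loop_piK -linearZ /= !loop_lift_pi linearZ.
Qed.
HB.instance Definition _ :=
  GRing.isScalable.Build C U B *:%R lift loop_lift_scalable.
End Lift.

Lemma loop_pi_rel x : loop_relator x -> loop_pi x = 0.
Proof.
move=> rx; rewrite -(rmorph0 loop_pi); apply/ideal_piE.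
by rewrite subr0 -[x]mul1r -[_ * x]mulr1; apply: ideal_genM.
Qed.

Lemma loopKE i j :
  loopK i * loopE j = q ^ (cartan i j %/ 2)%Z *: (loopE j * loopK i).
Proof.
apply/eqP; rewrite -subr_eq0; apply/eqP; rewrite -rmorph_qcomm_rel.
exact/loop_pi_rel/relKE.
Qed.
Lemma loopKF i j :
  loopK i * loopF j = q ^ (- cartan i j %/ 2)%Z *: (loopF j * loopK i).
Proof.
apply/eqP; rewrite -subr_eq0; apply/eqP; rewrite -rmorph_qcomm_rel.
exact/loop_pi_rel/relKF.
Qed.
Lemma loopEF i j : bracket (loopE i) (loopF j) =
  (i == j)%:R *: ((q - q^-1)^-1 *: (loopK i ^+ 2 - loopKinv i ^+ 2)).
Proof.
apply/eqP; rewrite -subr_eq0; apply/eqP; rewrite -rmorph_ef_rel.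
exact/loop_pi_rel/relEF.
Qed.
Lemma loopKKinv i : loopK i * loopKinv i = 1.
Proof.
apply/eqP; rewrite -subr_eq0; apply/eqP; rewrite -rmorph_inv_rel.
exact/loop_pi_rel/relKK'.
Qed.
Lemma loopKinvK i : loopKinv i * loopK i = 1.
Proof.
apply/eqP; rewrite -subr_eq0; apply/eqP; rewrite -rmorph_inv_rel.
exact/loop_pi_rel/relK'K.
Qed.
Lemma loopK0K1 : loopK 0 * loopK 1 = 1.
Proof.
apply/eqP; rewrite -subr_eq0; apply/eqP; rewrite -rmorph_inv_rel.
exact/loop_pi_rel/relK0K1.
Qed.
Lemma loopK1K0 : loopK 1 * loopK 0 = 1.
Proof.
apply/eqP; rewrite -subr_eq0; apply/eqP; rewrite -rmorph_inv_rel.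
exact/loop_pi_rel/relK1K0.
Qed.
Lemma loop_serreE i j : i != j -> serre q (loopE i) (loopE j) = 0.
Proof. by move=> ij; rewrite -rmorph_serre; apply/loop_pi_rel/relSerreE. Qed.
Lemma loop_serreF i j : i != j -> serre q (loopF i) (loopF j) = 0.
Proof. by move=> ij; rewrite -rmorph_serre; apply/loop_pi_rel/relSerreF. Qed.
End LoopAlgebra.

(* Used only to see that 1 (x) 1 is nonzero, as an nzRingType requires. *)
Lemma exists_linear_form (C : fieldType) (V : lmodType C) (v : V) :
  v != 0 ->
  exists f : V -> C, (forall c x y, f (c *: x + y) = c * f x + f y) /\ f v = 1.
Proof.
move=> v0.
pose closed (S : set V) := forall c x y, S x -> S y -> S (c *: x + y).
pose P (S : set V) := closed S /\ ~ S v.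
have [F FP Ftot|S [[Scl Sv] Smax]] := @Zorn_bigcup V P.
  split=> [c x y [X FX Xx] [Y FY Yy]|[X FX Xv]]; last by have [_] := FP _ FX.
  have [XY|YX] := Ftot _ _ FX FY.
    by exists Y => //; have [Ycl _] := FP _ FY; apply: Ycl => //; apply: XY.
  by exists X => //; have [Xcl _] := FP _ FX; apply: Xcl => //; apply: YX.
have S0 : S 0.
  apply: contrapT => nS0.
  have nS x : ~ S x.
    move=> Sx; apply: nS0.
    by rewrite -[0](addNr x) -scaleN1r; apply: Scl.
  apply: (Smax [set 0]%classic).
    by split=> [x /nS//|sub]; apply: nS0; apply: sub.
  by split=> [c x y -> ->|/esym/eqP]; [rewrite scaler0 addr0|rewrite eq_sym (negPf v0)].
have SZ c x : S x -> S (c *: x) by move=> Sx; rewrite -[_ *: _]addr0; apply: Scl.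
have SD x y : S x -> S y -> S (x + y) by move=> ? ?; rewrite -[x]scale1r; apply: Scl.
have key x : exists c, S (x - c *: v).
  have [Sx|nSx] := pselect (S x); first by exists 0; rewrite scale0r subr0.
  pose T := [set y : V | exists a s, S s /\ y = a *: x + s]%classic.
  have : ~ P T.
    apply: Smax; split=> [s Ss|sub]; first by exists 0, s; rewrite scale0r add0r.
    by apply: nSx; apply: sub; exists 1, 0; rewrite scale1r addr0.
  have Tcl : closed T.
    move=> c _ _ [a [s [Ss ->]]] [b [t [St ->]]].
    exists (c * a + b), (c *: s + t); split; first exact: Scl.
    by rewrite scalerDr scalerA scalerDl addrACA.
  move=> nPT; have [a [s [Ss va]]] : T v by apply: contrapT => nTv; apply: nPT.
  have a0 : a != 0.
    by apply/eqP => a0; apply: Sv; rewrite va a0 scale0r add0r.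
  exists a^-1; rewrite va scalerDr scalerA mulVf // scale1r opprD addrA subrr sub0r.
  by rewrite -scaleNr; apply: SZ.
have uniq x c d : S (x - c *: v) -> S (x - d *: v) -> c = d.
  move=> Sc Sd; apply/eqP/negP => /negP cd; apply: Sv.
  have cd0 : d - c != 0 by rewrite subr_eq0 eq_sym.
  have -> : v = (d - c)^-1 *: ((x - c *: v) + (-1) *: (x - d *: v)).
    rewrite scaleN1r opprB [_ + (d *: v - x)]addrC addrA subrK -scalerBl.
    by rewrite scalerA mulVf // scale1r.
  by apply: (SZ); apply: (SD) => //; apply: (SZ).
exists (fun x => sval (cid (key x))); split=> [c x y|].
  case: cid => a /= Sa; case: cid => b /= Sb; case: cid => d /= Sd.
  apply: (uniq _ _ _ Sa).
  have -> : c *: x + y - (c * b + d) *: v = c *: (x - b *: v) + (y - d *: v).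
    by rewrite scalerBr scalerA scalerDl opprD addrACA.
  exact: Scl.
case: cid => a /= Sa; apply: (uniq _ _ _ Sa).
by rewrite scale1r subrr.
Qed.

(* A formal sum a1 (x) b1 + ... + an (x) bn is the sequence of the pairs
   (ai, bi); scalars are absorbed in the first factor.  The tensor product is
   the quotient of formal sums by the bilinearity relations, and
   (a (x) b) (a' (x) b') = aa' (x) bb'. *)
Section Tensor.
Variables (C : fieldType) (A B : algType C).

Inductive tensor_eq : seq (A * B) -> seq (A * B) -> Prop :=
| tensor_refl s : tensor_eq s s
| tensor_sym s t : tensor_eq s t -> tensor_eq t s
| tensor_trans s t u : tensor_eq s t -> tensor_eq t u -> tensor_eq s u
| tensor_cat s s' t t' :
    tensor_eq s s' -> tensor_eq t t' -> tensor_eq (s ++ t) (s' ++ t')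
| tensor_catC s t : tensor_eq (s ++ t) (t ++ s)
| tensor_addl a a' b : tensor_eq [:: (a + a', b)] [:: (a, b); (a', b)]
| tensor_addr a b b' : tensor_eq [:: (a, b + b')] [:: (a, b); (a, b')]
| tensor_scale c a b : tensor_eq [:: (c *: a, b)] [:: (a, c *: b)]
| tensor_zero b : tensor_eq [:: (0, b)] [::].

Definition tensor_rel : rel (seq (A * B)) := fun s t => `[< tensor_eq s t >].

Lemma tensor_rel_equiv : equiv_class_of tensor_rel.
Proof.
split=> [s|s t|t s u]; first exact/asboolP/tensor_refl.
  by apply/asboolP/asboolP; apply: tensor_sym.
move=> /asboolP st /asboolP tu; exact/asboolP/(tensor_trans st).
Qed.
Canonical tensor_rel_eqrel := EquivRelPack tensor_rel_equiv.

Definition tensor := {eq_quot tensor_rel}.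
HB.instance Definition _ := EqQuotient.on tensor.
HB.instance Definition _ := Choice.on tensor.
Local Notation T := tensor.
Local Notation pi := (\pi_T : seq (A * B) -> T).

Lemma tensor_piE s t : tensor_eq s t <-> pi s = pi t.
Proof. by split=> [h|/eqmodP/asboolP //]; apply/eqmodP/asboolP. Qed.
Lemma tensor_pi_repr s : tensor_eq (repr (pi s)) s.
Proof. by apply/tensor_piE; rewrite reprK. Qed.

Lemma tensor_zeror a : tensor_eq [:: (a, 0)] [::].
Proof.
rewrite -[X in (a, X)](scale0r 0); apply: tensor_trans (tensor_sym _) _.
  exact: tensor_scale.
by rewrite scale0r; apply: tensor_zero.
Qed.

Lemma tensor_cons p s t : tensor_eq s t -> tensor_eq (p :: s) (p :: t).
Proof. exact: (tensor_cat (tensor_refl [:: p])). Qed.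

Section Universal.
Variables (V : lmodType C) (f : A -> B -> V).
Hypothesis fDl : forall a a' b, f (a + a') b = f a b + f a' b.
Hypothesis fDr : forall a b b', f a (b + b') = f a b + f a b'.
Hypothesis fZ : forall c a b, f (c *: a) b = f a (c *: b).

Lemma tensor_sum_congr s t : tensor_eq s t ->
  \sum_(p <- s) f p.1 p.2 = \sum_(p <- t) f p.1 p.2.
Proof.
elim=> {s t} [s|s t _ ->|s t u _ -> _ ->|s s' t t' _ ss _ tt|s t|a a' b|a b b'|c a b|b] //.
- by rewrite !big_cat /= ss tt.
- by rewrite !big_cat /= addrC.
- by rewrite !big_cons !big_nil /= !addr0 fDl.
- by rewrite !big_cons !big_nil /= !addr0 fDr.
- by rewrite !big_cons !big_nil /= !addr0 fZ.
- rewrite big_seq1 big_nil /=; apply: (addrI (f 0 b)).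
  by rewrite -fDl !addr0.
Qed.
End Universal.

Definition tns_opp_rep (s : seq (A * B)) := [seq (- p.1, p.2) | p <- s].
Definition tns_scale_rep (c : C) (s : seq (A * B)) := [seq (c *: p.1, p.2) | p <- s].
Definition tns_mul_rep (s t : seq (A * B)) :=
  [seq (p.1 * p'.1, p.2 * p'.2) | p <- s, p' <- t].

Definition tns_zero : T := pi [::].
Definition tns_one : T := pi [:: (1, 1)].
Definition tns_opp := lift_op1 T tns_opp_rep.
Definition tns_add := lift_op2 T (@cat (A * B)).
Definition tns_mul := lift_op2 T tns_mul_rep.
Definition tns_scale (c : C) := lift_op1 T (tns_scale_rep c).

Lemma tns_opp_congr s t : tensor_eq s t -> tensor_eq (tns_opp_rep s) (tns_opp_rep t).
Proof.
elim=> {s t} [s|s t _|s t u _ st _|s s' t t' _ ss _ tt|s t|a a' b|a b b'|c a b|b].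
- exact: tensor_refl.
- exact: tensor_sym.
- exact: tensor_trans.
- by rewrite /tns_opp_rep !map_cat; apply: tensor_cat.
- by rewrite /tns_opp_rep !map_cat; apply: tensor_catC.
- by rewrite /= opprD; apply: tensor_addl.
- exact: tensor_addr.
- by rewrite /= -scalerN; apply: tensor_scale.
- by rewrite /= oppr0; apply: tensor_zero.
Qed.

Lemma tns_scale_congr d s t :
  tensor_eq s t -> tensor_eq (tns_scale_rep d s) (tns_scale_rep d t).
Proof.
elim=> {s t} [s|s t _|s t u _ st _|s s' t t' _ ss _ tt|s t|a a' b|a b b'|c a b|b].
- exact: tensor_refl.
- exact: tensor_sym.
- exact: tensor_trans.
- by rewrite /tns_scale_rep !map_cat; apply: tensor_cat.
- by rewrite /tns_scale_rep !map_cat; apply: tensor_catC.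
- by rewrite /= scalerDr; apply: tensor_addl.
- exact: tensor_addr.
- by rewrite /= scalerA mulrC -scalerA; apply: tensor_scale.
- by rewrite /= scaler0; apply: tensor_zero.
Qed.

Lemma tns_mul_consr s p t :
  tensor_eq (tns_mul_rep s (p :: t)) (tns_mul_rep s [:: p] ++ tns_mul_rep s t).
Proof.
elim: s => [|x s ih] /=; first exact: tensor_refl.
apply: tensor_cons.
apply: tensor_trans (tensor_cat (tensor_refl _) ih) _.
rewrite !catA; apply: tensor_cat; last exact: tensor_refl.
exact: tensor_catC.
Qed.

Lemma tns_mul_catl s s' t :
  tns_mul_rep (s ++ s') t = tns_mul_rep s t ++ tns_mul_rep s' t.
Proof. by rewrite /tns_mul_rep allpairs_cat. Qed.

Lemma tns_mul_catr s t t' :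
  tensor_eq (tns_mul_rep s (t ++ t')) (tns_mul_rep s t ++ tns_mul_rep s t').
Proof.
elim: t => [|p t ih] /=.
  by rewrite /tns_mul_rep allpairs0r /=; apply: tensor_refl.
apply: tensor_trans (tns_mul_consr _ _ _) _.
apply: tensor_trans (tensor_cat (tensor_refl _) ih) _.
rewrite catA; apply: tensor_cat; last exact: tensor_refl.
exact/tensor_sym/tns_mul_consr.
Qed.

Lemma tns_mul_congrl s s' t :
  tensor_eq s s' -> tensor_eq (tns_mul_rep s t) (tns_mul_rep s' t).
Proof.
elim=> {s s'} [s|s s' _|s s' u _ st _|s s' u u' _ ss _ tt|s s'|a a' b|a b b'|c a b|b].
- exact: tensor_refl.
- exact: tensor_sym.
- exact: tensor_trans.
- by rewrite !tns_mul_catl; apply: tensor_cat.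
- by rewrite !tns_mul_catl; apply: tensor_catC.
- elim: t => [|p t ih]; first exact: tensor_refl.
  apply: tensor_trans (tns_mul_consr _ _ _) _.
  apply: tensor_sym; apply: tensor_trans (tns_mul_consr _ _ _) _.
  apply: tensor_sym; apply: tensor_cat ih.
  by rewrite /tns_mul_rep /= mulrDl; apply: tensor_addl.
- elim: t => [|p t ih]; first exact: tensor_refl.
  apply: tensor_trans (tns_mul_consr _ _ _) _.
  apply: tensor_sym; apply: tensor_trans (tns_mul_consr _ _ _) _.
  apply: tensor_sym; apply: tensor_cat ih.
  by rewrite /tns_mul_rep /= mulrDl; apply: tensor_addr.
- elim: t => [|p t ih]; first exact: tensor_refl.
  apply: tensor_trans (tns_mul_consr _ _ _) _.
  apply: tensor_sym; apply: tensor_trans (tns_mul_consr _ _ _) _.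
  apply: tensor_sym; apply: tensor_cat ih.
  by rewrite /tns_mul_rep /= -!scalerAl; apply: tensor_scale.
- elim: t => [|p t ih]; first exact: tensor_refl.
  apply: tensor_trans (tns_mul_consr _ _ _) _.
  apply: (@tensor_cat _ [::] _ [::]) ih.
  by rewrite /tns_mul_rep /= mul0r; apply: tensor_zero.
Qed.

Lemma tns_mul_congrr s t t' :
  tensor_eq t t' -> tensor_eq (tns_mul_rep s t) (tns_mul_rep s t').
Proof.
elim=> {t t'} [t|t t' _|t t' u _ st _|t t' u u' _ ss _ tt|t t'|a a' b|a b b'|c a b|b].
- exact: tensor_refl.
- exact: tensor_sym.
- exact: tensor_trans.
- apply: tensor_trans (tns_mul_catr _ _ _) _.
  apply: tensor_sym; apply: tensor_trans (tns_mul_catr _ _ _) _.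
  by apply: tensor_sym; apply: tensor_cat.
- apply: tensor_trans (tns_mul_catr _ _ _) _.
  apply: tensor_sym; apply: tensor_trans (tns_mul_catr _ _ _) _.
  exact: tensor_catC.
- elim: s => [|p s ih]; first exact: tensor_refl.
  rewrite -![p :: s]cat1s !tns_mul_catl; apply: tensor_cat ih.
  by rewrite /tns_mul_rep /= mulrDr; apply: tensor_addl.
- elim: s => [|p s ih]; first exact: tensor_refl.
  rewrite -![p :: s]cat1s !tns_mul_catl; apply: tensor_cat ih.
  by rewrite /tns_mul_rep /= mulrDr; apply: tensor_addr.
- elim: s => [|p s ih]; first exact: tensor_refl.
  rewrite -![p :: s]cat1s !tns_mul_catl; apply: tensor_cat ih.
  by rewrite /tns_mul_rep /= -!scalerAr; apply: tensor_scale.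
- elim: s => [|p s ih]; first exact: tensor_refl.
  rewrite -![p :: s]cat1s !tns_mul_catl.
  apply: tensor_cat ih.
  by rewrite /tns_mul_rep /= mulr0; apply: tensor_zero.
Qed.

Lemma tns_oppE s : tns_opp (pi s) = pi (tns_opp_rep s).
Proof. by unlock tns_opp; apply/tensor_piE/tns_opp_congr/tensor_pi_repr. Qed.
Lemma tns_addE s t : tns_add (pi s) (pi t) = pi (s ++ t).
Proof.
by unlock tns_add; apply/tensor_piE; apply: tensor_cat; apply: tensor_pi_repr.
Qed.
Lemma tns_mulE s t : tns_mul (pi s) (pi t) = pi (tns_mul_rep s t).
Proof.
unlock tns_mul; apply/tensor_piE.
apply: tensor_trans (tns_mul_congrl _ (tensor_pi_repr _)) _.
exact/tns_mul_congrr/tensor_pi_repr.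
Qed.
Lemma tns_scaleE c s : tns_scale c (pi s) = pi (tns_scale_rep c s).
Proof. by unlock tns_scale; apply/tensor_piE/tns_scale_congr/tensor_pi_repr. Qed.

Let tnsE := (tns_oppE, tns_addE, tns_mulE, tns_scaleE).

Lemma tns_addA : associative tns_add.
Proof.
by move=> x y z; rewrite -[x]reprK -[y]reprK -[z]reprK !tnsE catA.
Qed.
Lemma tns_addC : commutative tns_add.
Proof.
move=> x y; rewrite -[x]reprK -[y]reprK !tnsE.
exact/tensor_piE/tensor_catC.
Qed.
Lemma tns_add0 : left_id tns_zero tns_add.
Proof. by move=> x; rewrite -[x]reprK !tnsE. Qed.
Lemma tns_addN : left_inverse tns_zero tns_opp tns_add.
Proof.
move=> x; rewrite -[x]reprK !tnsE; apply/tensor_piE.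
elim: (repr x) => [|[a b] s ih] /=; first exact: tensor_refl.
apply: (@tensor_trans _ ([:: (- a, b); (a, b)] ++ (tns_opp_rep s ++ s))).
  apply: tensor_cons; rewrite -cat1s catA.
  by rewrite -[X in tensor_eq _ X]cat1s catA; apply: tensor_cat;
     [apply: tensor_catC|apply: tensor_refl].
apply: (@tensor_cat _ [::] _ [::]) ih.
apply: tensor_trans (tensor_sym (tensor_addl _ _ _)) _.
by rewrite addNr; apply: tensor_zero.
Qed.
HB.instance Definition _ :=
  GRing.isZmodule.Build T tns_addA tns_addC tns_add0 tns_addN.

Lemma tns_mulA : associative tns_mul.
Proof.
move=> x y z; rewrite -[x]reprK -[y]reprK -[z]reprK !tnsE; congr (pi _).
elim: (repr x) => [//|p s ih]; rewrite -cat1s !tns_mul_catl ih; congr (_ ++ _).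
rewrite /tns_mul_rep /= !cats0; elim: (repr y) => [//|p' t ih'] /=.
rewrite map_cat ih' -map_comp; congr (_ ++ _).
by apply: eq_map => u /=; rewrite !mulrA.
Qed.
Lemma tns_mul1l : left_id tns_one tns_mul.
Proof.
move=> x; rewrite -[x]reprK !tnsE; congr (pi _).
rewrite /tns_mul_rep /= cats0 -[RHS]map_id; apply: eq_map => -[a b] /=.
by rewrite !mul1r.
Qed.
Lemma tns_mul1r : right_id tns_one tns_mul.
Proof.
move=> x; rewrite -[x]reprK !tnsE; congr (pi _).
rewrite /tns_mul_rep allpairs1r -[RHS]map_id; apply: eq_map => -[a b] /=.
by rewrite !mulr1.
Qed.
Lemma tns_mulDl : left_distributive tns_mul tns_add.
Proof.
by move=> x y z; rewrite -[x]reprK -[y]reprK -[z]reprK !tnsE tns_mul_catl.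
Qed.
Lemma tns_mulDr : right_distributive tns_mul tns_add.
Proof.
move=> x y z; rewrite -[x]reprK -[y]reprK -[z]reprK !tnsE.
exact/tensor_piE/tns_mul_catr.
Qed.
HB.instance Definition _ :=
  GRing.Zmodule_isPzRing.Build T tns_mulA tns_mul1l tns_mul1r tns_mulDl tns_mulDr.

Lemma tns_scaleA a b x : tns_scale a (tns_scale b x) = tns_scale (a * b) x.
Proof.
rewrite -[x]reprK !tnsE; congr (pi _); rewrite /tns_scale_rep -map_comp.
by apply: eq_map => p /=; rewrite scalerA.
Qed.
Lemma tns_scale1 : left_id 1 tns_scale.
Proof.
move=> x; rewrite -[x]reprK !tnsE; congr (pi _); rewrite -[RHS]map_id.
by apply: eq_map => -[a b] /=; rewrite scale1r.
Qed.
Lemma tns_scaleDr : right_distributive tns_scale +%R.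
Proof.
move=> c x y; rewrite -[x]reprK -[y]reprK /GRing.add /= !tnsE.
by rewrite /tns_scale_rep map_cat.
Qed.
Lemma tns_scaleDl x : {morph tns_scale^~ x : a b / a + b}.
Proof.
move=> a b; rewrite -[x]reprK /GRing.add /= !tnsE; apply/tensor_piE.
elim: (repr x) => [|[u v] s ih] /=; first exact: tensor_refl.
apply: (@tensor_trans _ ([:: (a *: u, v); (b *: u, v)]
                          ++ (tns_scale_rep a s ++ tns_scale_rep b s))).
  by apply: (@tensor_cat [:: _]) ih; rewrite scalerDl; apply: tensor_addl.
apply: tensor_cons; rewrite -cat1s catA -[X in tensor_eq _ (_ ++ X)]cat1s catA.
by apply: tensor_cat; [apply: tensor_catC|apply: tensor_refl].
Qed.
HB.instance Definition _ :=
  GRing.Zmodule_isLmodule.Build C T tns_scaleA tns_scale1 tns_scaleDr tns_scaleDl.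

Definition tpure (a : A) (b : B) : T := pi [:: (a, b)].

Lemma tpureDl a a' b : tpure (a + a') b = tpure a b + tpure a' b.
Proof. by rewrite /GRing.add /= tnsE; apply/tensor_piE/tensor_addl. Qed.
Lemma tpureDr a b b' : tpure a (b + b') = tpure a b + tpure a b'.
Proof. by rewrite /GRing.add /= tnsE; apply/tensor_piE/tensor_addr. Qed.
Lemma tpureZl c a b : tpure (c *: a) b = c *: tpure a b.
Proof. by rewrite /GRing.scale /= tnsE. Qed.
Lemma tpureZr c a b : tpure a (c *: b) = c *: tpure a b.
Proof. by rewrite -tpureZl; apply/tensor_piE/tensor_sym/tensor_scale. Qed.
Lemma tpureM a a' b b' : tpure a b * tpure a' b' = tpure (a * a') (b * b').
Proof. by rewrite /GRing.mul /= tnsE. Qed.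
Lemma tpure11 : tpure 1 1 = 1. Proof. by []. Qed.

Lemma tensor_reprE (x : T) : x = \sum_(p <- repr x) tpure p.1 p.2.
Proof.
rewrite -[LHS]reprK; elim: (repr x) => [|[a b] s ih]; first by rewrite big_nil.
by rewrite big_cons -ih /GRing.add /= tnsE.
Qed.

Section Lift.
Variables (V : lmodType C) (f : A -> B -> V).
Hypothesis fDl : forall a a' b, f (a + a') b = f a b + f a' b.
Hypothesis fDr : forall a b b', f a (b + b') = f a b + f a b'.
Hypothesis fZl : forall c a b, f (c *: a) b = c *: f a b.
Hypothesis fZr : forall c a b, f a (c *: b) = c *: f a b.

Definition tensor_lift (x : T) : V := \sum_(p <- repr x) f p.1 p.2.

Lemma tensor_lift_pi s : tensor_lift (pi s) = \sum_(p <- s) f p.1 p.2.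
Proof.
apply: (@tensor_sum_congr _ f) => [//|//|c a b|]; first by rewrite fZl fZr.
exact: tensor_pi_repr.
Qed.
Lemma tensor_lift_pure a b : tensor_lift (tpure a b) = f a b.
Proof. by rewrite tensor_lift_pi big_seq1. Qed.
Lemma tensor_liftD x y : tensor_lift (x + y) = tensor_lift x + tensor_lift y.
Proof.
rewrite -[x]reprK -[y]reprK [X in tensor_lift X]tns_addE !tensor_lift_pi.
by rewrite big_cat.
Qed.
Lemma tensor_liftZ c x : tensor_lift (c *: x) = c *: tensor_lift x.
Proof.
rewrite -[x]reprK [X in tensor_lift X]tns_scaleE !tensor_lift_pi.
by rewrite big_map scaler_sumr; apply: eq_bigr => p _ /=.
Qed.
End Lift.

Lemma tensor_oner_neq0 : 1 != 0 :> T.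
Proof.
have [f [flin f1]] := exists_linear_form (oner_neq0 A).
have [g [glin g1]] := exists_linear_form (oner_neq0 B).
have lin (V : lmodType C) (h : V -> C)
    (hl : forall c x y, h (c *: x + y) = c * h x + h y) :
    (forall x y, h (x + y) = h x + h y) /\ (forall c x, h (c *: x) = c * h x).
  have hD x y : h (x + y) = h x + h y by rewrite -[x]scale1r hl mul1r scale1r.
  split=> // c x; have h0 : h 0 = 0.
    by apply: (addrI (h 0)); rewrite -hD !addr0.
  by rewrite -[c *: x]addr0 hl h0 addr0.
have [fD fZ] := lin _ _ flin; have [gD gZ] := lin _ _ glin.
pose h a b : C^o := f a * g b.
apply/eqP => e10; have : tensor_lift h 1 = tensor_lift h 0 by rewrite e10.
rewrite -tpure11 tensor_lift_pure ?tensor_lift_pi ?big_nil /h.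
- by rewrite f1 g1 mulr1 => /eqP; rewrite oner_eq0.
- by move=> a a' b; rewrite fD mulrDl.
- by move=> a b b'; rewrite gD mulrDr.
- by move=> c a b; rewrite fZ -mulrA.
- by move=> c a b; rewrite gZ mulrCA.
- by move=> a a' b; rewrite fD mulrDl.
- by move=> a b b'; rewrite gD mulrDr.
- by move=> c a b; rewrite fZ -mulrA.
- by move=> c a b; rewrite gZ mulrCA.
Qed.
HB.instance Definition _ := GRing.PzSemiRing_isNonZero.Build T tensor_oner_neq0.

Lemma tensor_ind (P : T -> Prop) :
  P 0 -> (forall x y, P x -> P y -> P (x + y)) -> (forall a b, P (tpure a b)) ->
  forall x, P x.
Proof.
by move=> P0 PD Pp x; rewrite [x]tensor_reprE; apply: big_ind.
Qed.

Lemma tensor_scaleAl (c : C) (x y : T) : c *: (x * y) = (c *: x) * y.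
Proof.
elim/tensor_ind: x => [|x x' hx hx'|a b]; first by rewrite mul0r !scaler0 mul0r.
  by rewrite mulrDl !scalerDr mulrDl hx hx'.
elim/tensor_ind: y => [|y y' hy hy'|a' b']; first by rewrite !mulr0 scaler0.
  by rewrite !mulrDr scalerDr hy hy'.
by rewrite -tpureZl !tpureM -tpureZl scalerAl.
Qed.
HB.instance Definition _ := GRing.Lmodule_isLalgebra.Build C T tensor_scaleAl.
Lemma tensor_scaleAr (c : C) (x y : T) : c *: (x * y) = x * (c *: y).
Proof.
elim/tensor_ind: y => [|y y' hy hy'|a' b']; first by rewrite !(mulr0, scaler0).
  by rewrite mulrDr !scalerDr mulrDr hy hy'.
elim/tensor_ind: x => [|x x' hx hx'|a b]; first by rewrite !(mul0r, scaler0).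
  by rewrite !mulrDl scalerDr hx hx'.
by rewrite -tpureZl !tpureM -tpureZl scalerAr.
Qed.
HB.instance Definition _ := GRing.Lalgebra_isAlgebra.Build C T tensor_scaleAr.
End Tensor.

Section Swap.
Variables (C : fieldType) (A B : algType C).
Definition tensor_swap : tensor A B -> tensor B A :=
  tensor_lift (fun a b => tpure b a).

Lemma tensor_swap_pure a b : tensor_swap (tpure a b) = tpure b a.
Proof.
by apply: tensor_lift_pure => *; rewrite ?(tpureDl, tpureDr, tpureZl, tpureZr).
Qed.
Lemma tensor_swapD x y : tensor_swap (x + y) = tensor_swap x + tensor_swap y.
Proof.
by apply: tensor_liftD => *; rewrite ?(tpureDl, tpureDr, tpureZl, tpureZr).
Qed.
Lemma tensor_swapZ : scalable tensor_swap.
Proof.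
by move=> c x; apply: tensor_liftZ => *;
   rewrite ?(tpureDl, tpureDr, tpureZl, tpureZr).
Qed.
Lemma tensor_swap_zmod : zmod_morphism tensor_swap.
Proof. by move=> x y; rewrite tensor_swapD -scaleN1r tensor_swapZ scaleN1r. Qed.
HB.instance Definition _ :=
  GRing.isZmodMorphism.Build _ _ tensor_swap tensor_swap_zmod.
Lemma tensor_swap_monoid : monoid_morphism tensor_swap.
Proof.
split=> [|x y]; first by rewrite -tpure11 tensor_swap_pure.
elim/tensor_ind: x => [|x x' hx hx'|a b]; first by rewrite mul0r raddf0 mul0r.
  by rewrite mulrDl !tensor_swapD mulrDl hx hx'.
elim/tensor_ind: y => [|y y' hy hy'|a' b']; first by rewrite mulr0 raddf0 mulr0.
  by rewrite mulrDr !tensor_swapD mulrDr hy hy'.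
by rewrite tpureM !tensor_swap_pure tpureM.
Qed.
HB.instance Definition _ :=
  GRing.isMonoidMorphism.Build _ _ tensor_swap tensor_swap_monoid.
HB.instance Definition _ :=
  GRing.isScalable.Build C (tensor A B) (tensor B A) *:%R tensor_swap tensor_swapZ.
End Swap.

(* If YX = p^2 XY and YZ = p^-2 ZY, the Serre relation for (X, Z) implies the
   one for (X + Y, Z); this gives the compatibility of Delta with the Serre
   relations, splitting Delta (E i) = E i (x) K i^-1 + K i (x) E i. *)
Section SerreCoproduct.
Variables (C : fieldType) (A : algType C).
Implicit Types (p q : C) (X Y Z : A).

Lemma qbracketDl q X Y Z : qbracket q (X + Y) Z = qbracket q X Z + qbracket q Y Z.
Proof. by rewrite /qbracket mulrDl mulrDr !scalerDr opprD addrACA. Qed.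
Lemma qbracketDr q X Y Z : qbracket q X (Y + Z) = qbracket q X Y + qbracket q X Z.
Proof. by rewrite /qbracket mulrDl mulrDr !scalerDr opprD addrACA. Qed.
Lemma bracketDr X Y Z : bracket X (Y + Z) = bracket X Y + bracket X Z.
Proof. by rewrite /bracket mulrDl mulrDr opprD addrACA. Qed.
Lemma bracketDl X Y Z : bracket (X + Y) Z = bracket X Z + bracket Y Z.
Proof. by rewrite /bracket mulrDl mulrDr opprD addrACA. Qed.
Lemma bracketZr c X Y : bracket X (c *: Y) = c *: bracket X Y.
Proof. by rewrite /bracket -scalerAl -scalerAr scalerBr. Qed.
Lemma serreDr q X Y Z : serre q X (Y + Z) = serre q X Y + serre q X Z.
Proof. by rewrite /serre !qbracketDr bracketDr. Qed.

Lemma serreV q X Y : serre q^-1 X Y = serre q X Y.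
Proof.
rewrite /serre /qbracket invrK; congr bracket.
rewrite !mulrBl !mulrBr -!scalerAl -!scalerAr !scalerBr !scalerA !mulrA.
have [->|q0] := eqVneq q 0; first by rewrite invr0 !mulr0 !scale0r.
rewrite mulfV // mulVf // !opprB !addrA.
by rewrite [LHS]addrAC [RHS]addrAC; congr (_ + _); rewrite addrAC.
Qed.

Lemma serre_qcomm p X Y Z : p != 0 ->
  Y * X = p ^+ 2 *: (X * Y) -> Y * Z = p ^- 2 *: (Z * Y) -> serre p X Z = 0 ->
  serre p (X + Y) Z = 0.
Proof.
move=> p0 YX YZ XZ; rewrite /serre.
have -> : qbracket p (X + Y) Z = qbracket p X Z.
  rewrite qbracketDl {2}/qbracket YZ scalerA -scalerBl.
  have -> : p * p ^- 2 - p^-1 = 0 by field.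
  by rewrite scale0r addr0.
move: XZ; rewrite /serre; set P1 := qbracket p X Z.
have YP1 : Y * P1 = P1 * Y.
  rewrite /P1 /qbracket mulrBr mulrBl -!scalerAl -!scalerAr !mulrA YX YZ.
  rewrite -!scalerAl -!mulrA YX YZ -!scalerAr !scalerA.
  by congr (_ *: _ - _ *: _); field.
rewrite qbracketDl; clearbody P1; set P2 := qbracket p^-1 X P1 => XP2.
have -> : qbracket p^-1 Y P1 = (p^-1 - p) *: (P1 * Y).
  by rewrite /qbracket invrK YP1 -scalerBl.
have YP2 : Y * P2 = p ^+ 2 *: (P2 * Y).
  rewrite /P2 /qbracket mulrBr mulrBl -!scalerAl -!scalerAr !mulrA YX YP1.
  rewrite -!scalerAl -!mulrA YX YP1 -!scalerAr scalerBr !scalerA.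
  by congr (_ *: _ - _ *: _); rewrite mulrC.
have XP1Y : bracket X (P1 * Y) = p *: (P2 * Y).
  rewrite /bracket /P2 /qbracket mulrBl -!scalerAl scalerBr !scalerA invrK mulfV //.
  by rewrite scale1r -!mulrA YX -scalerAr expr2.
clearbody P2; rewrite bracketDl !bracketDr !bracketZr XP2 add0r.
have -> : bracket Y (P1 * Y) = 0 by rewrite /bracket mulrA YP1 subrr.
have -> : bracket Y P2 = (p ^+ 2 - 1) *: (P2 * Y).
  by rewrite /bracket YP2 scalerBl scale1r.
rewrite XP1Y.
rewrite scaler0 addr0 scalerA -scalerDl.
have -> : (p^-1 - p) * p + (p ^+ 2 - 1) = 0 by field.
by rewrite scale0r.
Qed.

Lemma qcommV p (k k' x : A) : p != 0 -> k * k' = 1 -> k' * k = 1 ->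
  k * x = p *: (x * k) -> k' * x = p^-1 *: (x * k').
Proof.
move=> p0 kk' k'k kx.
have xk : x * k = p^-1 *: (k * x) by rewrite kx scalerA mulVf // scale1r.
rewrite -[LHS]mulr1 -kk' mulrA -[k' * x * k]mulrA xk.
by rewrite -scalerAr -scalerAl !mulrA k'k mul1r.
Qed.
End SerreCoproduct.

Section SerreTensor.
Variables (C : fieldType) (A : algType C).
Local Notation T := (tensor A A).

Lemma tpure0l (b : A) : tpure 0 b = 0 :> T.
Proof. by apply: (addrI (tpure 0 b)); rewrite -tpureDl !addr0. Qed.
Lemma tpure0r (a : A) : tpure a 0 = 0 :> T.
Proof. by apply: (addrI (tpure a 0)); rewrite -tpureDr !addr0. Qed.
Lemma tpureBl (a a' b : A) : tpure (a - a') b = tpure a b - tpure a' b :> T.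
Proof. by rewrite -[- a']scaleN1r tpureDl tpureZl scaleN1r. Qed.
Lemma tpureBr (a b b' : A) : tpure a (b - b') = tpure a b - tpure a b' :> T.
Proof. by rewrite -[- b']scaleN1r tpureDr tpureZr scaleN1r. Qed.

Lemma qbracket_purel q (x z u v : A) : u * v = v * u ->
  qbracket q (tpure x u : T) (tpure z v) = tpure (qbracket q x z) (u * v).
Proof. by move=> uv; rewrite /qbracket !tpureM tpureBl !tpureZl uv. Qed.
Lemma bracket_purel (x z u v : A) : u * v = v * u ->
  bracket (tpure x u : T) (tpure z v) = tpure (bracket x z) (u * v).
Proof. by move=> uv; rewrite /bracket !tpureM tpureBl uv. Qed.
Lemma serre_purel q (x z u v : A) : u * v = v * u ->
  serre q x z = 0 -> serre q (tpure x u : T) (tpure z v) = 0.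
Proof.
move=> uv xz; rewrite /serre qbracket_purel // qbracket_purel; last first.
  by rewrite {1}uv mulrA.
rewrite bracket_purel; first by rewrite -/(serre q x z) xz tpure0l.
by rewrite -!mulrA; congr (_ * _); rewrite {1}uv mulrA.
Qed.
Lemma qbracket_purer q (x z u v : A) : u * v = v * u ->
  qbracket q (tpure u x : T) (tpure v z) = tpure (u * v) (qbracket q x z).
Proof. by move=> uv; rewrite /qbracket !tpureM tpureBr !tpureZr uv. Qed.
Lemma bracket_purer (x z u v : A) : u * v = v * u ->
  bracket (tpure u x : T) (tpure v z) = tpure (u * v) (bracket x z).
Proof. by move=> uv; rewrite /bracket !tpureM tpureBr uv. Qed.
Lemma serre_purer q (x z u v : A) : u * v = v * u ->
  serre q x z = 0 -> serre q (tpure u x : T) (tpure v z) = 0.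
Proof.
move=> uv xz; rewrite /serre qbracket_purer // qbracket_purer; last first.
  by rewrite {1}uv mulrA.
rewrite bracket_purer; first by rewrite -/(serre q x z) xz tpure0r.
by rewrite -!mulrA; congr (_ * _); rewrite {1}uv mulrA.
Qed.

Lemma serre_coproduct p (x z k k' : A) : p != 0 -> k * k' = 1 -> k' * k = 1 ->
  k * x = p *: (x * k) -> k * z = p^-1 *: (z * k) -> serre p x z = 0 ->
  serre p (tpure x k' + tpure k x : T) (tpure z k + tpure k' z) = 0.
Proof.
move=> p0 kk' k'k kx kz xz.
have p'0 : p^-1 != 0 by rewrite invr_eq0.
have k'x := qcommV p0 kk' k'k kx.
have k'z := qcommV p'0 kk' k'k kz; rewrite invrK in k'z.
have xk : x * k = p^-1 *: (k * x) by rewrite kx scalerA mulVf // scale1r.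
have xk' : x * k' = p *: (k' * x) by rewrite k'x scalerA mulfV // scale1r.
rewrite serreDr (serre_qcomm (p := p)) //; first 1 last.
- by rewrite !tpureM kx xk' tpureZl tpureZr scalerA -expr2.
- by rewrite !tpureM kz xk tpureZl tpureZr scalerA expr2 invfM.
- by apply: serre_purel => //; rewrite kk' k'k.
rewrite add0r addrC -serreV serre_qcomm //.
- rewrite !tpureM kx xk' tpureZl tpureZr !scalerA exprVn expr2.
  by rewrite mulVf ?scale1r // mulf_neq0.
- by rewrite !tpureM xk' k'z tpureZl tpureZr scalerA -expr2 exprVn invrK.
- by rewrite serreV; apply: serre_purer => //; rewrite kk' k'k.
Qed.
End SerreTensor.

Section BracketCoproduct.
Variables (C : fieldType) (A : algType C).
Lemma bracket_coproduct (a : C) (e f k k' l l' : A) :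
  l * e = a *: (e * l) -> l' * e = a^-1 *: (e * l') ->
  k * f = a^-1 *: (f * k) -> k' * f = a *: (f * k') ->
  k * l = l * k -> k' * l' = l' * k' ->
  bracket (tpure e k' + tpure k e) (tpure f l' + tpure l f) =
  tpure (bracket e f) (k' * l') + tpure (k * l) (bracket e f) :> tensor A A.
Proof.
move=> le l'e kf k'f kl k'l'.
rewrite /bracket tpureBl tpureBr !mulrDl !mulrDr !tpureM le l'e kf k'f kl k'l'.
rewrite !tpureZl !tpureZr.
rewrite (addrACA (tpure (f * e) _)) opprD addrACA.
by congr (_ + _); rewrite opprD addrACA subrr ?addr0 ?add0r.
Qed.

Lemma ef_coproduct (a : C) (k k' : A) :
  tpure (a *: (k ^+ 2 - k' ^+ 2)) (k' * k') + tpure (k * k) (a *: (k ^+ 2 - k' ^+ 2))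
  = a *: (tpure k k ^+ 2 - tpure k' k' ^+ 2) :> tensor A A.
Proof.
rewrite tpureZl tpureZr tpureBl tpureBr -scalerDr !expr2 !tpureM addrC.
by rewrite subrKA.
Qed.

Lemma qcomm_coproduct (a : C) (k l l' x : A) :
  k * x = a *: (x * k) -> k * l' = l' * k -> k * l = l * k ->
  tpure k k * (tpure x l' + tpure l x) = a *: ((tpure x l' + tpure l x) * tpure k k)
  :> tensor A A.
Proof.
move=> kx kl' kl.
by rewrite mulrDr mulrDl scalerDr !tpureM kx kl' kl tpureZl tpureZr.
Qed.
End BracketCoproduct.

Section Coproduct.
Variables (C : fieldType) (q : C).
Local Notation U := (loop_alg q).
Local Notation T := (tensor U U).
Local Notation E := (loopE q).
Local Notation F := (loopF q).
Local Notation K := (loopK q).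
Local Notation K' := (loopKinv q).

Lemma ord2_dichotomy (i : 'I_2) : i = 0 \/ i = 1.
Proof. by case: i => -[|[|//]] lti; [left|right]; apply: val_inj. Qed.

Lemma loopK_inv i j : i != j -> K i * K j = 1.
Proof.
case: (ord2_dichotomy i) => ->; case: (ord2_dichotomy j) => -> // _.
  exact: loopK0K1.
exact: loopK1K0.
Qed.

Lemma loopKinv_eq i j : i != j -> K' i = K j.
Proof.
by move=> /loopK_inv ij; rewrite -[RHS]mul1r -(loopKinvK q i) -mulrA ij mulr1.
Qed.

Lemma loopKC i j : K i * K j = K j * K i.
Proof.
by have [->//|ij] := eqVneq i j; rewrite !loopK_inv // eq_sym.
Qed.
Lemma loopKinvC i j : K' i * K' j = K' j * K' i.
Proof.
have [->//|ij] := eqVneq i j.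
by rewrite (loopKinv_eq ij) (@loopKinv_eq j i) 1?eq_sym // loopKC.
Qed.

Lemma cartan_sym i j : cartan i j = cartan j i.
Proof. by rewrite /cartan eq_sym. Qed.
Lemma half_cartanN i j : (- cartan i j %/ 2)%Z = - (cartan i j %/ 2)%Z.
Proof. by rewrite /cartan; case: eqP. Qed.

Definition Delta_gen (x : loop_gen) : T :=
  match x with
  | LE i => tpure (E i) (K' i) + tpure (K i) (E i)
  | LF i => tpure (F i) (K' i) + tpure (K i) (F i)
  | LK i => tpure (K i) (K i)
  | LKinv i => tpure (K' i) (K' i)
  end.

Hypothesis q0 : q != 0.

Lemma Delta_qcomm c i (x : U) j :
  K i * x = c *: (x * K i) ->
  tpure (K i) (K i) * (tpure x (K' j) + tpure (K j) x)
  = c *: ((tpure x (K' j) + tpure (K j) x) * tpure (K i) (K i)) :> T.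
Proof.
move=> Kx; have KK' : K i * K' j = K' j * K i.
  have [->|ij] := eqVneq i j; first by rewrite loopKKinv loopKinvK.
  by rewrite (@loopKinv_eq j i) // eq_sym.
exact: qcomm_coproduct Kx KK' (loopKC i j).
Qed.

Lemma Delta_relator x : loop_relator q x -> fa_eval Delta_gen x = 0.
Proof.
case=> [i j|i j|i j|i|i|||i j ij|i j ij].
- rewrite rmorph_qcomm_rel /= !fa_eval_gen /=.
  by apply/eqP; rewrite subr_eq0; apply/eqP/Delta_qcomm/loopKE.
- rewrite rmorph_qcomm_rel /= !fa_eval_gen /=.
  by apply/eqP; rewrite subr_eq0; apply/eqP/Delta_qcomm/loopKF.
- rewrite rmorph_ef_rel /= !fa_eval_gen /=.
  pose a := q ^ (cartan i j %/ 2)%Z.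
  have a0 : a != 0 by apply: expfz_neq0.
  have KE : K j * E i = a *: (E i * K j) by rewrite loopKE cartan_sym.
  have KF : K i * F j = a^-1 *: (F j * K i).
    by rewrite loopKF half_cartanN -invr_expz.
  have K'E := qcommV a0 (loopKKinv q j) (loopKinvK q j) KE.
  have K'F : K' i * F j = a *: (F j * K' i).
    have a'0 : a^-1 != 0 by rewrite invr_eq0.
    by have := qcommV a'0 (loopKKinv q i) (loopKinvK q i) KF; rewrite invrK.
  rewrite (bracket_coproduct KE K'E KF K'F (loopKC i j) (loopKinvC i j)) loopEF.
  case: eqVneq => [<-|_]; last by rewrite !scale0r tpure0l tpure0r addr0 subrr.
  by rewrite !scale1r ef_coproduct subrr.
- rewrite rmorph_inv_rel /= !fa_eval_gen /=.
  by rewrite tpureM !loopKKinv tpure11 subrr.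
- rewrite rmorph_inv_rel /= !fa_eval_gen /=.
  by rewrite tpureM !loopKinvK tpure11 subrr.
- rewrite rmorph_inv_rel /= !fa_eval_gen /=.
  by rewrite tpureM !loopK0K1 tpure11 subrr.
- rewrite rmorph_inv_rel /= !fa_eval_gen /=.
  by rewrite tpureM !loopK1K0 tpure11 subrr.
- rewrite rmorph_serre /= !fa_eval_gen /= -(loopKinv_eq ij) (loopKinv_eq (i:=j) (j:=i)) 1?eq_sym //.
  apply: serre_coproduct; rewrite ?loopKKinv ?loopKinvK ?loop_serreE //.
    by rewrite loopKE /cartan eqxx.
  by rewrite loopKE /cartan (negPf ij).
- rewrite rmorph_serre /= !fa_eval_gen /= -(loopKinv_eq ij) (loopKinv_eq (i:=j) (j:=i)) 1?eq_sym //.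
  rewrite -serreV.
  apply: serre_coproduct; rewrite ?loopKKinv ?loopKinvK ?serreV ?loop_serreF ?invr_eq0 //.
    by rewrite loopKF /cartan eqxx.
  by rewrite loopKF /cartan (negPf ij) invrK.
Qed.

Definition Delta : {lrmorphism U -> T} := loop_lift Delta_relator.
(* sigma \o Delta, where sigma (x (x) y) = y (x) x. *)
Definition Delta_op : {lrmorphism U -> T} := @tensor_swap C U U \o Delta.

Lemma Delta_E i : Delta (E i) = tpure (E i) (K' i) + tpure (K i) (E i).
Proof. by rewrite /Delta /= loop_lift_pi fa_eval_gen. Qed.
Lemma Delta_F i : Delta (F i) = tpure (F i) (K' i) + tpure (K i) (F i).
Proof. by rewrite /Delta /= loop_lift_pi fa_eval_gen. Qed.
Lemma Delta_K i : Delta (K i) = tpure (K i) (K i).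
Proof. by rewrite /Delta /= loop_lift_pi fa_eval_gen. Qed.
Lemma Delta_Kinv i : Delta (K' i) = tpure (K' i) (K' i).
Proof. by rewrite /Delta /= loop_lift_pi fa_eval_gen. Qed.
End Coproduct.

Section QDolanGrady.
Variables (C : fieldType) (A : algType C).
Definition q_Dolan_Grady (q rho : C) (W0 W1 : A) : Prop :=
  bracket W0 (qbracket q^-1 W0 (qbracket q W0 W1)) = rho *: bracket W0 W1 /\
  bracket W1 (qbracket q^-1 W1 (qbracket q W1 W0)) = rho *: bracket W1 W0.
End QDolanGrady.

Section HatElements.
Variables (C : fieldType) (q : C).
Local Notation E := (loopE q).
Local Notation F := (loopF q).
Local Notation K := (loopK q).

Definition Ahat (alpha : C) : loop_alg q :=
  (q - q^-1) *: (E 1 * K 1 - F 1 * K 1) + alpha *: (K 1 ^+ 2).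
Definition Bhat (beta : C) : loop_alg q :=
  (q - q^-1) *: (F 0 * K 0 - E 0 * K 0) + beta *: (K 0 ^+ 2).
End HatElements.

(* Main.v *)
(* [Delta] and [Delta_op] are algebra morphisms, so it suffices to treat [Ahat]
   and [Bhat] themselves.  Put
     W_i(a) = (q - q^-1)(e_i k_i - f_i k_i) + a k_i^2,
   so that Ahat = W_1(alpha) and Bhat = - W_0(-beta).  The relation
     [X, [X, [X, Z]_q]_{q^-1}] = rho [X, Z]
   is linear in Z and invariant under X -> - X, so it is enough to prove it for
   X = W_i(a), i <> j, and Z one of e_j k_j, f_j k_j, k_j^2.  For Z = e_j k_j
   split X = u + v, where v is the multiple of f_i k_i: then u and Z satisfy the
   q-Serre relation, v and Z q-commute, and moving v to the right of u and Z
   leaves only the lower order term rho [X, Z].  The case Z = f_j k_j is the same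
   with q^-1 for q and the roles of e and f exchanged, and the case Z = k_j^2 uses
   the same splitting. *)
Require Import Defs.
From mathcomp Require Import all_boot all_order all_algebra.
From mathcomp Require Import reals complex.
From mathcomp Require Import ring.

Set Implicit Arguments.
Unset Strict Implicit.
Unset Printing Implicit Defensive.

Import GRing.Theory.
Local Open Scope ring_scope.

(** * Linear identities by comparison of coefficients *)

Inductive lexpr (C : Type) :=
| LVar of nat | LZero | LAdd of lexpr C & lexpr C | LOpp of lexpr C
| LScale of C & lexpr C.
Arguments LVar {C}.
Arguments LZero {C}.

Section LinearReflection.
Variables (C : pzRingType) (V : lmodType C).

Fixpoint leval (vs : seq V) (e : lexpr C) : V :=
  match e with
  | LVar n => nth 0 vs n
  | LZero => 0
  | LAdd a b => leval vs a + leval vs b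
  | LOpp a => - leval vs a
  | LScale c a => c *: leval vs a
  end.

(** Indices are compared with [eqn] so that [cbn] decides each test in [lin]. *)
Fixpoint lcoef (i : nat) (e : lexpr C) : C :=
  match e with
  | LVar n => if eqn n i then 1 else 0
  | LZero => 0
  | LAdd a b => lcoef i a + lcoef i b
  | LOpp a => - lcoef i a
  | LScale c a => c * lcoef i a
  end.

Fixpoint lcoef_eq (n : nat) (a b : lexpr C) : Prop :=
  if n is n'.+1 then lcoef n' a = lcoef n' b /\ lcoef_eq n' a b else True.

Lemma leval_coef vs e : leval vs e = \sum_(i < size vs) lcoef i e *: vs`_i.
Proof.
elim: e => [n||a IHa b IHb|a IHa|k a IHa] /=; rewrite ?IHa ?IHb.
- case: (ltnP n (size vs)) => [lt_n|le_n].
    rewrite (bigD1 (Ordinal lt_n)) //= -[eqn n n]/(n == n) eqxx scale1r.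
    rewrite big1 ?addr0 // => i; rewrite -[eqn n i]/(n == i) eq_sym -val_eqE.
    by move=> /negPf /= ->; rewrite scale0r.
  (* An index out of range evaluates to the default 0 and meets no index of the sum. *)
  rewrite nth_default // big1 // => i _; rewrite -[eqn n i]/(n == i).
  by rewrite gtn_eqF ?scale0r // (leq_trans (ltn_ord i)).
- by rewrite big1 // => i _; rewrite scale0r.
- by rewrite -big_split; apply: eq_bigr => i _; rewrite scalerDl.
- by rewrite -sumrN; apply: eq_bigr => i _; rewrite scaleNr.
- by rewrite scaler_sumr; apply: eq_bigr => i _; rewrite scalerA.
Qed.

(** This turns an identity between combinations of monomials into scalar goals for [field]; the
    atoms may be dependent. *)
Lemma leval_eq vs a b : lcoef_eq (size vs) a b -> leval vs a = leval vs b.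
Proof.
rewrite !leval_coef => eq_ab; apply: eq_bigr => i _; congr (_ *: _).
elim: (size vs) eq_ab (i : nat) (ltn_ord i) => //= n IHn [eq_n /IHn{}IHn] j.
by rewrite ltnS leq_eqVlt => /predU1P[->|/IHn].
Qed.
End LinearReflection.

(* The inferred ring structures may differ syntactically between two copies of
   the same product, so products are compared factor by factor. *)
Ltac lin_same x y :=
  lazymatch constr:((x, y)) with
  | (?z, ?z) => constr:(true)
  | (1%R, 1%R) => constr:(true)
  | ((?a * ?b)%R, (?a' * ?b')%R) =>
    lazymatch lin_same b b' with true => lin_same a a' | false => constr:(false) end
  | _ => constr:(false)
  end.
Ltac lin_mem x l :=
  lazymatch l with
  | nil => constr:(false)
  | cons ?y ?l' =>
    lazymatch lin_same x y with true => constr:(true) | false => lin_mem x l' end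
  end.
Ltac lin_index x l :=
  lazymatch l with
  | cons ?y ?l' =>
    lazymatch lin_same x y with
    | true => constr:(O)
    | false => let n := lin_index x l' in constr:(S n)
    end
  end.
Ltac lin_atoms e l :=
  lazymatch e with
  | (?a + ?b)%R => let l' := lin_atoms a l in lin_atoms b l'
  | (- ?a)%R => lin_atoms a l
  | (_ *: ?a)%R => lin_atoms a l
  | 0%R => l
  | _ => lazymatch lin_mem e l with true => l | false => constr:(cons e l) end
  end.
Ltac lin_reify C e l :=
  lazymatch e with
  | (?a + ?b)%R => let a' := lin_reify C a l in let b' := lin_reify C b l in
                   constr:(@LAdd C a' b')
  | (- ?a)%R => let a' := lin_reify C a l in constr:(@LOpp C a')
  | (?c *: ?a)%R => let a' := lin_reify C a l in constr:(@LScale C c a')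
  | 0%R => constr:(@LZero C)
  | _ => let n := lin_index e l in constr:(@LVar C n)
  end.

Ltac lin :=
  lazymatch goal with
  | C : fieldType |- @eq ?V ?x ?y =>
    let l := lin_atoms x (@nil V) in let l := lin_atoms y l in
    let a := lin_reify C x l in let b := lin_reify C y l in
    apply: (@leval_eq _ _ l a b);
    cbn [lcoef_eq lcoef eqn size]; repeat split
  end.

(** Normal form: combinations of left-associated monomials. As products lean left, a commutation
    rule also needs a copy behind an arbitrary prefix [w]. *)
Definition expandE (C : fieldType) (A : algType C) :=
  (@mulrDl A, @mulrDr A, @mulNr A, @mulrN A,
   fun k x y => esym (@scalerAl C A k x y),
   fun k x y => esym (@scalerAr C A k x y),
   @mulrA A, @scalerDr C A, @scalerN C A, @mul1r A, @mulr1 A).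

(** * The Serre bracket under scaling and torus twists *)

Section SerreScaling.
Variables (C : fieldType) (A : algType C).

Lemma qbracketZl p (a : C) (X Y : A) :
  qbracket p (a *: X) Y = a *: qbracket p X Y.
Proof.
by rewrite /qbracket -scalerAl -scalerAr scalerBr !scalerA mulrC [a * p^-1]mulrC.
Qed.

Lemma qbracketZr p (a : C) (X Y : A) :
  qbracket p X (a *: Y) = a *: qbracket p X Y.
Proof.
by rewrite /qbracket -scalerAl -scalerAr scalerBr !scalerA mulrC [a * p^-1]mulrC.
Qed.

Lemma bracketZl (a : C) (X Y : A) : bracket (a *: X) Y = a *: bracket X Y.
Proof. by rewrite /bracket -scalerAl -scalerAr scalerBr. Qed.

Lemma serreZr p (a : C) (X Y : A) : serre p X (a *: Y) = a *: serre p X Y.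
Proof. by rewrite /serre !qbracketZr bracketZr. Qed.

Lemma serreZl p (a : C) (X Y : A) : serre p (a *: X) Y = a ^+ 3 *: serre p X Y.
Proof.
rewrite /serre !qbracketZl qbracketZr bracketZl !bracketZr !scalerA.
by congr (_ *: _); ring.
Qed.

(** In the first bracket [k] and [k'] cancel at the cost of p^-1, leaving an element that commutes
    with [k]; the last bracket moves [k] past elements of weight p, which restores the factor. *)
Lemma serre_twist q p (e e' k k' : A) : p != 0 -> k * k' = 1 -> k' * k = 1 ->
  k * e = p *: (e * k) -> k * e' = p^-1 *: (e' * k) ->
  serre q (e * k) (e' * k') = serre q e e' * (k * k).
Proof.
move=> p0 kk' k'k ke ke'.
have k'e := qcommV p0 kk' k'k ke; rewrite /serre.
have -> : qbracket q (e * k) (e' * k') = p^-1 *: qbracket q e e'.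
  have eke'k' : e * k * (e' * k') = p^-1 *: (e * e').
    rewrite mulrA -[e * k * e']mulrA ke' -scalerAr -scalerAl !mulrA.
    by rewrite -[_ * k * k']mulrA kk' mulr1.
  have e'k'ek : e' * k' * (e * k) = p^-1 *: (e' * e).
    rewrite mulrA -[e' * k' * e]mulrA k'e -scalerAr -scalerAl !mulrA.
    by rewrite -[_ * k' * k]mulrA k'k mulr1.
  by rewrite /qbracket eke'k' e'k'ek scalerBr !scalerA ![p^-1 * _]mulrC.
have : k * qbracket q e e' = qbracket q e e' * k.
  rewrite /qbracket mulrBr mulrBl -!scalerAl -!scalerAr !mulrA ke ke'.
  by rewrite -!scalerAl -!mulrA ke ke' -!scalerAr !scalerA mulfK // mulfVK.
move: (qbracket q e e') => P kP; rewrite qbracketZr bracketZr.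
have -> : qbracket q^-1 (e * k) P = qbracket q^-1 e P * k.
  by rewrite /qbracket mulrBl -!scalerAl -!mulrA kP.
have : k * qbracket q^-1 e P = p *: (qbracket q^-1 e P * k).
  rewrite /qbracket mulrBr mulrBl -!scalerAl -!scalerAr !mulrA ke kP.
  rewrite -!scalerAl -!mulrA ke kP -!scalerAr scalerBr !scalerA.
  by congr (_ *: _ - _ *: _); rewrite mulrC.
move: (qbracket _ e P) => Q kQ.
rewrite /bracket -mulrA [k * _]mulrA kQ [Q * k * _]mulrA -[Q * k * e]mulrA ke.
rewrite -!scalerAr -!scalerAl -!scalerAr -scalerBr scalerA mulVf // scale1r.
by rewrite mulrBl !mulrA.
Qed.
End SerreScaling.

(** * Serre brackets with lower order terms *)

Section Ladders.
Variables (C : fieldType) (A : algType C) (q : C).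
Hypothesis q0 : q != 0.
Let c := q - q^-1.
Let d := q ^+ 2 - q ^- 2.

(** Deformation of [serre_qcomm], which is the case H = T = 0: the right-hand side collects what H
    adds each time v moves right. *)
Lemma serreDl_qweyl (u v H T Z : A) :
  v * u = q ^+ 2 *: (u * v) + (q * c) *: H ->
  v * Z = q ^- 2 *: (Z * v) ->
  q ^+ 2 *: (H * Z) - q ^- 2 *: (Z * H) = d *: T ->
  serre q u Z = 0 ->
  serre q (u + v) Z =
    (c * d) *: ((q + q^-1) *: bracket u T + q^-1 *: bracket v T - c *: (T * v))
    + c *: bracket H (qbracket q u Z).
Proof.
move=> vu vZ HZ; rewrite /serre; set P := qbracket q u Z => uQ.
have vuw w : w * v * u = q ^+ 2 *: (w * u * v) + (q * c) *: (w * H).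
  by rewrite -mulrA vu mulrDr -!scalerAr mulrA.
have -> : qbracket q (u + v) Z = P.
  rewrite qbracketDl {2}/qbracket vZ scalerA -scalerBl.
  by have -> : q * q ^- 2 - q^-1 = 0 by [field]; rewrite scale0r addr0.
(* The factors q^2 and q^-2 cancel; the H-terms form c (q^2 H Z - q^-2 Z H). *)
have vP : v * P = P * v + (c * d) *: T.
  rewrite -scalerA -HZ /P /qbracket.
  have vZw w : w * v * Z = q ^- 2 *: (w * Z * v).
    by rewrite -mulrA vZ -!scalerAr mulrA.
  rewrite !(expandE A, vu, vZ, vuw, vZw).
  by lin; rewrite /c; field.
move: P vP uQ => P vP; set Q := qbracket _ u P => uQ.
have vQ : v * Q = q ^+ 2 *: (Q * v) + (q * c * d) *: bracket u T
    + c *: (H * P) - (q ^+ 2 * c) *: (P * H).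
  have vPw w : w * v * P = w * P * v + (c * d) *: (w * T).
    by rewrite -mulrA vP mulrDr -!scalerAr mulrA.
  rewrite /Q /qbracket /bracket invrK !(expandE A, vu, vuw, vP, vPw).
  by lin; rewrite /c; field.
rewrite qbracketDl -/Q.
have -> : qbracket q^-1 v P = - c *: (P * v) + (q^-1 * c * d) *: T.
  by rewrite /qbracket invrK vP; lin; rewrite /c; field.
(* Written through u and P, the Q v terms cancel: q^2 - 1 from [v, Q] against - q c from
   [u, - c P v]. *)
have QE : Q = q^-1 *: (u * P) - q *: (P * u) by rewrite /Q /qbracket invrK.
clearbody Q; rewrite bracketDl !bracketDr uQ add0r /bracket.
rewrite !(expandE A, vuw, vP, vQ) QE /bracket !(expandE A).
by lin; rewrite /c; field.
Qed.

Section Ladder.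
Variables (x v k : A) (a : C).
Hypothesis kx : k * x = q ^+ 2 *: (x * k).
Hypothesis kv : k * v = q ^- 2 *: (v * k).
Hypothesis vx : v * x = q ^+ 2 *: (x * v) + (q * c) *: (k * k - 1).

Let u := x + a *: k.
Let vu : v * u = q ^+ 2 *: (u * v) + (q * c) *: (k * k - 1).
Proof.
rewrite /u !(expandE A, kv, vx).
by lin; rewrite /c; field.
Qed.
Let kxw w : w * k * x = q ^+ 2 *: (w * x * k).
Proof. by rewrite -mulrA kx -scalerAr mulrA. Qed.

(** Here [k] models k_i^2, while [x] and [v] model the multiples of e_i k_i and f_i k_i. *)
Lemma serre_ladder z :
  v * z = q ^- 2 *: (z * v) -> k * z = q ^- 2 *: (z * k) -> serre q x z = 0 ->
  serre q (x + v + a *: k) z = - d ^+ 2 *: bracket (x + v + a *: k) z.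
Proof.
move=> vz kz xz; rewrite addrAC.
have kzw w : w * k * z = q ^- 2 *: (w * z * k).
  by rewrite -mulrA kz -scalerAr mulrA.
(* In q^2 H z - q^-2 z H the k^2 parts cancel, leaving - d z; hence T = - z. *)
rewrite (serreDl_qweyl (H := k * k - 1) (T := - z) vu vz); first last.
- apply: serre_qcomm q0 _ _ xz.
    by rewrite -!scalerAl kx -!scalerAr !scalerA mulrC.
  by rewrite -scalerAl -scalerAr kz !scalerA mulrC.
- rewrite !(expandE A, kz, kzw).
  by lin; rewrite /d; field.
have uz : qbracket q u z = qbracket q x z.
  by rewrite /u /qbracket !(expandE A, kz); lin; field.
(* The weights of x and z under k are inverse, so the bracket with H vanishes. *)
have kP : k * qbracket q x z = qbracket q x z * k.
  by rewrite /qbracket !(expandE A, kz, kzw, kx, kxw); lin; field.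
have -> : bracket (k * k - 1) (qbracket q u z) = 0.
  rewrite uz; move: (qbracket q x z) kP => P kP.
  by rewrite /bracket mulrBl mulrBr mul1r mulr1 -mulrA kP mulrA kP -mulrA subrr.
rewrite /u /bracket !(expandE A, vz).
by lin; rewrite /d /c; field.
Qed.

Lemma serre_ladder_torus l : k * l = 1 -> l * k = 1 ->
  serre q (x + v + a *: k) l = - d ^+ 2 *: bracket (x + v + a *: k) l.
Proof.
move=> kl lk; rewrite addrAC.
have lx : l * x = q ^- 2 *: (x * l).
  exact: qcommV (expf_neq0 2 q0) kl lk kx.
have vl : v * l = q ^- 2 *: (l * v).
  have qV0 : q ^- 2 != 0 by rewrite invr_neq0 // expf_neq0.
  by rewrite (qcommV qV0 kl lk kv) scalerA mulfV // scale1r.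
have klw w : w * k * l = w by rewrite -mulrA kl mulr1.
have lkw w : w * l * k = w by rewrite -mulrA lk mulr1.
have lxw w : w * l * x = q ^- 2 *: (w * x * l).
  by rewrite -mulrA lx -scalerAr mulrA.
have ul : qbracket q u l = (q^-1 * d) *: (x * l) + (c * a) *: 1.
  rewrite /u /qbracket !(expandE A, kl, lk, lx).
  by lin; rewrite /d /c; field.
(* A multiple of u, so the outermost bracket with u is zero. *)
have uxl : qbracket q^-1 u ((q^-1 * d) *: (x * l) + (c * a) *: 1) =
    - (c ^+ 2 * a) *: u.
  rewrite /u /qbracket invrK !(expandE A, kl, lk, klw, lkw, kx, kxw, lx, lxw).
  by lin; rewrite /d /c; field.
(* Both H l and l H equal k - l, which gives T. *)
rewrite (serreDl_qweyl (H := k * k - 1) (T := k - l) vu vl); first last.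
- by rewrite /serre ul uxl /bracket -scalerAl -scalerAr subrr.
- rewrite !(expandE A, kl, lk, klw, lkw).
  by lin; rewrite /d; field.
rewrite ul /u /bracket !(expandE A, kl, lk, klw, lkw, kx, kxw, lx, lxw, kv, vl).
by lin; rewrite /d /c; field.
Qed.
End Ladder.
End Ladders.

(** * The relation for abstract generators of two nodes *)

Section Hats.
Variables (C : fieldType) (A : algType C) (q : C).
Hypothesis q0 : q != 0.
Let c := q - q^-1.
Let d := q ^+ 2 - q ^- 2.
Variables (e f k e' f' k' : A).
Hypotheses (kk' : k * k' = 1) (k'k : k' * k = 1).
Hypotheses (ke : k * e = q *: (e * k)) (kf : k * f = q^-1 *: (f * k)).
Hypotheses (ke' : k * e' = q^-1 *: (e' * k)) (kf' : k * f' = q *: (f' * k)).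
Hypothesis ef : c *: bracket e f = k * k - k' * k'.
Hypotheses (ef' : e * f' = f' * e) (fe' : f * e' = e' * f).
Hypotheses (ee' : serre q e e' = 0) (ff' : serre q f f' = 0).

Let k'e := qcommV q0 kk' k'k ke.
Let qV0 : q^-1 != 0. Proof. by rewrite invr_eq0. Qed.
Let k'f : k' * f = q *: (f * k').
Proof. by rewrite (qcommV qV0 kk' k'k kf) invrK. Qed.
Let kew w : w * k * e = q *: (w * e * k).
Proof. by rewrite -mulrA ke -scalerAr mulrA. Qed.
Let kfw w : w * k * f = q^-1 *: (w * f * k).
Proof. by rewrite -mulrA kf -scalerAr mulrA. Qed.

Let x := c *: (e * k).
Let v := - c *: (f * k).

Let kx : (k * k) * x = q ^+ 2 *: (x * (k * k)).
Proof. by rewrite /x !(expandE A, ke, kew); lin; field. Qed.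

Let kv : (k * k) * v = q ^- 2 *: (v * (k * k)).
Proof. by rewrite /v !(expandE A, kf, kfw); lin; field. Qed.

Let vx : v * x = q ^+ 2 *: (x * v) + (q * c) *: (k * k * (k * k) - 1).
Proof.
(* The factor k^2 clears [k'] from the Cartan part of [e, f]. *)
have -> : k * k * (k * k) - 1 = c *: bracket e f * (k * k).
  by rewrite ef mulrBl -!mulrA [k' * (k * k)]mulrA k'k mul1r k'k.
rewrite /v /x /bracket !(expandE A, ke, kf, kew, kfw).
by lin; rewrite /c; field.
Qed.

Lemma serre_hat a b :
  serre q (c *: (e * k - f * k) + a *: (k * k))
    (c *: (e' * k' - f' * k') + b *: (k' * k')) =
  - d ^+ 2 *: bracket (c *: (e * k - f * k) + a *: (k * k))
    (c *: (e' * k' - f' * k') + b *: (k' * k')).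
Proof.
have -> : c *: (e * k - f * k) = x + v by rewrite scalerBr -scaleNr.
have kk'w w : w * k * k' = w by rewrite -mulrA kk' mulr1.
have k'kw w : w * k' * k = w by rewrite -mulrA k'k mulr1.
have ke'w w : w * k * e' = q^-1 *: (w * e' * k).
  by rewrite -mulrA ke' -scalerAr mulrA.
have kf'w w : w * k * f' = q *: (w * f' * k).
  by rewrite -mulrA kf' -scalerAr mulrA.
have k'ew w : w * k' * e = q^-1 *: (w * e * k').
  by rewrite -mulrA k'e -scalerAr mulrA.
have k'fw w : w * k' * f = q *: (w * f * k').
  by rewrite -mulrA k'f -scalerAr mulrA.
have normE := (kk'w, k'kw, ke', ke'w, kf', kf'w, k'ew, k'fw, ef', fe').
set W := x + v + a *: (k * k).
have [se sf sk] : [/\ serre q W (e' * k') = - d ^+ 2 *: bracket W (e' * k'),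
    serre q W (f' * k') = - d ^+ 2 *: bracket W (f' * k') &
    serre q W (k' * k') = - d ^+ 2 *: bracket W (k' * k')].
  split.
  - apply: (serre_ladder q0 _ kx kv vx).
    + by rewrite /v !(expandE A, normE); lin; field.
    + by rewrite !(expandE A, normE); lin; field.
    + by rewrite serreZl (serre_twist q q0 kk' k'k ke ke') ee' mul0r scaler0.
  (* The relations [kx], [kv], [vx] are stable under exchanging x with v and q with q^-1, which also
     fixes d^2. *)
  - rewrite /W [x + v]addrC -serreV.
    have -> : d ^+ 2 = (q^-1 ^+ 2 - q^-1 ^- 2) ^+ 2.
      by rewrite /d exprVn invrK -sqrrN opprB.
    apply: (serre_ladder qV0).
    + by rewrite kv exprVn.
    + by rewrite kx exprVn invrK.
    + by rewrite vx !invrK; lin; rewrite /c; field.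
    + by rewrite exprVn invrK /x !(expandE A, normE); lin; field.
    + by rewrite exprVn invrK !(expandE A, normE); lin; field.
    + rewrite serreV serreZl (serre_twist _ qV0 kk' k'k kf) ?invrK //.
      by rewrite ff' mul0r scaler0.
  - apply: (serre_ladder_torus q0 _ kx kv vx).
    + by rewrite -mulrA [k * (k' * k')]mulrA kk' mul1r.
    + by rewrite -mulrA [k' * (k * k)]mulrA k'k mul1r.
clearbody W.
rewrite scalerBr -scaleNr !serreDr !serreZr se sf sk !bracketDr !bracketZr.
by lin; ring.
Qed.
End Hats.

(** * Transport to the loop algebra and its tensor square *)

Lemma rmorph_q_Dolan_Grady (C : fieldType) (A B : algType C)
    (g : {lrmorphism A -> B}) (q rho : C) (W0 W1 : A) :
  q_Dolan_Grady q rho W0 W1 -> q_Dolan_Grady q rho (g W0) (g W1).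
Proof.
move=> [W01 W10]; rewrite /q_Dolan_Grady -!rmorph_qbracket -!rmorph_bracket.
by rewrite W01 W10 !linearZ_LR.
Qed.

Section LoopHats.
Variables (C : fieldType) (q : C).
Hypotheses (q0 : q != 0) (q2 : q ^+ 2 != 1).
Local Notation E := (loopE q).
Local Notation F := (loopF q).
Local Notation K := (loopK q).

Let hat (i : 'I_2) (a : C) : loop_alg q :=
  (q - q^-1) *: (E i * K i - F i * K i) + a *: (K i * K i).

(** As k_0 k_1 = 1, [K j] serves both as inverse of [K i] and as torus generator of node j. *)
Lemma serre_loop_hat (i j : 'I_2) (a b : C) : i != j ->
  serre q (hat i a) (hat j b) =
  - (q ^+ 2 - q ^- 2) ^+ 2 *: bracket (hat i a) (hat j b).
Proof.
move=> ij; have ji : j != i by rewrite eq_sym.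
apply: (serre_hat q0).
- exact: loopK_inv.
- exact: loopK_inv.
- by rewrite loopKE /cartan eqxx.
- by rewrite loopKF /cartan eqxx.
- by rewrite loopKE /cartan (negPf ij).
- by rewrite loopKF /cartan (negPf ij).
(* The denominator q - q^-1 is invertible because q^2 differs from 1. *)
- rewrite loopEF eqxx scale1r (loopKinv_eq q ij) scalerA mulfV ?scale1r //.
  apply: contraNneq q2 => /eqP; rewrite subr_eq0 => /eqP qV.
  by rewrite expr2 {2}qV mulfV.
- by apply/eqP; rewrite -subr_eq0 -/(bracket _ _) loopEF (negPf ij) scale0r.
- apply/eqP; rewrite eq_sym -subr_eq0 -/(bracket _ _) loopEF (negPf ji).
  by rewrite scale0r.
- exact: loop_serreE.
- exact: loop_serreF.
Qed.

Lemma Ahat_Bhat_q_Dolan_Grady (alpha beta : C) :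
  q_Dolan_Grady q (- (q ^+ 2 - q ^- 2) ^+ 2) (Ahat q alpha) (Bhat q beta).
Proof.
have -> : Ahat q alpha = hat 1 alpha by [].
have -> : Bhat q beta = - 1 *: hat 0 (- beta).
  by rewrite /Bhat /hat scaleN1r opprD scaleNr opprK -scalerN opprB.
rewrite /q_Dolan_Grady -!/(serre _ _ _) serreZl serreZr.
rewrite !serre_loop_hat // bracketZr bracketZl !scalerA; split.
  by rewrite mulrC.
(* The nested bracket is cubic in its first argument: (-1)^3 = -1 matches the sign on the right. *)
by rewrite -signr_odd expr1 mulrC.
Qed.
End LoopHats.

Theorem lemma3p2 (R : realType) (q : R[i]) (q_neq0 : q != 0)
    (q_nroot : forall n : nat, (0 < n)%N -> q ^+ n != 1)
    (alpha beta : R[i]) :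
  q_Dolan_Grady q (- (q ^+ 2 - q ^- 2) ^+ 2)
    (Delta q_neq0 (Ahat q alpha)) (Delta q_neq0 (Bhat q beta)) /\
  q_Dolan_Grady q (- (q ^+ 2 - q ^- 2) ^+ 2)
    (Delta_op q_neq0 (Ahat q alpha)) (Delta_op q_neq0 (Bhat q beta)).
Proof.
have AB := Ahat_Bhat_q_Dolan_Grady q_neq0 (q_nroot 2 isT) alpha beta.
by split; apply: rmorph_q_Dolan_Grady.
Qed.
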